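(* Let $d\ge 2$, let $\Gamma$ be a $\mathbb Z^d$-periodic equilateral metric graph and let $\Gamma_1$ be a fundamental domain of $\Gamma$. Let $\nu=\#V_F$, $\nu_1=\#V_1$, $\nu_o=\#V_o$. Let $\Omega$ be the restriction of $\sqrt{\Delta_M}$ to the spectral interval $[0,\pi]$, with bands $\sigma_n(\Omega)=[z_n^-,z_n^+]$, $n=1,\ldots,\nu$, and let $z_1^1\le\ldots\le z_{\nu_1}^1$ and $z_1^o\le\ldots\le z_{\nu_o}^o$ be the first $\nu_1$, respectively $\nu_o$, eigenvalues (counted with multiplicity) of the restrictions $\Omega_1$ and $\Omega_o$ to $[0,\pi]$ of the square roots of the Neumann operator $\Delta_M^1$ and the Dirichlet operator $\Delta_M^o$ on $\Gamma_1$. Then each band $\sigma_n(\Omega)$ of the operator $\Omega$ acting on $L^2(\Gamma)$ satisfies $$\sigma_n(\Omega)\subset J_n\cap K_n,\qquad n=1,\ldots,\nu,$$ where $$J_n=\begin{cases}[z_n^1,z_n^o], & n=1,\ldots,\nu_o,\\ [z_n^1,\pi], & n=\nu_o+1,\ldots,\nu,\end{cases}$$ $$K_n=\begin{cases}[0,z_{n+\nu_1-\nu}^1], & n=1,\ldots,\nu-\nu_o,\\ [z_{n-\nu+\nu_o}^o,\,z_{n+\nu_1-\nu}^1], & n=\nu-\nu_o+1,\ldots,\nu.\end{cases}$$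
   Context: **Periodic graphs.** $\Gamma=(V,\mathcal E)$ is a connected infinite graph embedded in $\mathbb R^d$, possibly with loops and multiple edges, with vertex set $V$ and set $\mathcal E$ of unoriented edges. The degree $\varkappa_v$ of $v\in V$ is the number of edges incident to $v$, a loop being counted twice. $\Gamma$ is a $\mathbb Z^d$-periodic equilateral graph if: (1) every bounded domain in $\mathbb R^d$ contains finitely many vertices; (2) all degrees are finite; (3) there is a basis $a_1,\ldots,a_d$ of $\mathbb R^d$ with $\Gamma+a_s=\Gamma$ for $s=1,\ldots,d$; (4) all edges have unit length. Coordinates in $\mathbb R^d$ are taken with respect to a fixed origin and the basis $a_1,\ldots,a_d$, so that $\Gamma+m=\Gamma$ for all $m\in\mathbb Z^d$; two vertices or edges are $\mathbb Z^d$-equivalent if one is the translate of the other by some $m\in\mathbb Z^d$. The fundamental graph is the finite graph $\Gamma_F=(V_F,\mathcal E_F)=\Gamma/\mathbb Z^d$; its vertex set is identified with $V_F=[0,1)^d\cap V=\{v_1,\ldots,v_\nu\}$, $\nu=\#V_F<\infty$. Each $v\in V$ is written uniquely as $v=[v]+\tilde v$ with $[v]\in\mathbb Z^d$, $\tilde v\in V_F$. For an oriented edge $\mathbf e=(u,v)$ of $\Gamma$ its index is $\tau(\mathbf e)=[v]-[u]\in\mathbb Z^d$; it is invariant under $\mathbb Z^d$-translations and therefore defines an index for each oriented edge of $\Gamma_F$. **Metric Laplacian.** Each edge $\mathbf e$ is given an orientation ($\mathbb Z^d$-invariantly on $\Gamma$) and is identified with $[0,1]$ with coordinate $t$. $L^2(\Gamma)$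 is the Hilbert space of $y=(y_{\mathbf e})_{\mathbf e\in\mathcal E}$, $y_{\mathbf e}\in L^2(0,1)$, with $\|y\|^2=\sum_{\mathbf e}\|y_{\mathbf e}\|^2_{L^2(0,1)}<\infty$. The metric Laplacian is $(\Delta_M y)_{\mathbf e}=-y_{\mathbf e}''$ with $(y_{\mathbf e}'')_{\mathbf e}\in L^2(\Gamma)$, on functions $y$ satisfying the Kirchhoff conditions: $y$ is continuous on $\Gamma$ and, for every vertex $v$, $\sum\delta_{\mathbf e}(v)y_{\mathbf e}'(v)=0$, the sum being over edges incident to $v$ (both ends of a loop contribute), where $\delta_{\mathbf e}(v)=1$ at the terminal end ($t=1$) and $-1$ at the initial end ($t=0$). It is self-adjoint and nonnegative. **Bands.** Let $\mathbb T^d=\mathbb R^d/(2\pi\mathbb Z)^d$. $\Delta_M$ is unitarily equivalent to the direct integral $\frac1{(2\pi)^d}\int^\oplus_{\mathbb T^d}\Delta_M(\vartheta)\,d\vartheta$, where the Floquet operator $\Delta_M(\vartheta)$ on $L^2(\Gamma_F)$ acts by $(\Delta_M(\vartheta)y)_{\mathbf e}=\big(i\frac{\partial}{\partial t}+\langle\tau(\mathbf e),\vartheta\rangle\big)^2y_{\mathbf e}$, $(y_{\mathbf e}'')_{\mathbf e\in\mathcal E_F}\in L^2(\Gamma_F)$, on functions $y$ that are continuous on $\Gamma_F$ and satisfy at each vertex $v\in V_F$ the Kirchhoff condition $\sum\delta_{\mathbf e}(v)\big(y_{\mathbf e}'(v)-i\langle\tau(\mathbf e),\vartheta\rangle y_{\mathbf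 e}(v)\big)=0$ (same summation convention). Its eigenvalues, counted with multiplicity, are $z_1^2(\vartheta)\le z_2^2(\vartheta)\le\ldots$ with $z_n(\vartheta)\ge0$; each $z_n$ is continuous on $\mathbb T^d$. Define $\Omega=\sqrt{\Delta_M}\,\chi_{[0,\pi]}(\sqrt{\Delta_M})$, regarded as the restriction of $\sqrt{\Delta_M}$ to its spectral subspace for $[0,\pi]$ ($\chi_A$ is the characteristic function of $A$). Its bands are $\sigma_n(\Omega)=[z_n^-,z_n^+]=z_n(\mathbb T^d)\subset[0,\pi]$, $n=1,\ldots,\nu$ (possibly degenerate to points). **Fundamental domain.** A subgraph $\Gamma_1=(V_1,\mathcal E_1)$ of $\Gamma$ is a fundamental domain if: (1) it is a finite connected graph with $V_1\supset V_F$; (2) it contains no two distinct $\mathbb Z^d$-equivalent edges; (3) $\bigcup_{m\in\mathbb Z^d}(\Gamma_1+m)=\Gamma$. Let $\varkappa_v^1$ be the degree of $v\in V_1$ in $\Gamma_1$. The set of inner vertices is $V_o=\{v\in V_1:\varkappa_v=\varkappa_v^1\}$ and the boundary is $\partial V_1=V_1\setminus V_o$. One has $V_o\subset V_F$, so $0\le\nu_o\le\nu\le\nu_1$. **Neumann and Dirichlet operators on $\Gamma_1$.** The Neumann operator $\Delta_M^1$ on $L^2(\Gamma_1)$ is the metric Laplacian $y\mapsto(-y_{\mathbf e}'')_{\mathbf e\in\mathcal E_1}$ with continuity and Kirchhoff conditions at all vertices of $\Gamma_1$ (with respect to the edges of $\Gamma_1$). The self-adjoint Dirichlet operator $\Delta_M^o$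 on $L^2(\Gamma_1)$ acts as $y\mapsto(-y_{\mathbf e}'')_{\mathbf e\in\mathcal E_1}$ on continuous functions that vanish at all vertices of $\partial V_1$ and satisfy the Kirchhoff conditions at all vertices of $V_o$. For $\phi\in\{o,1\}$, $\Omega_\phi=(\Delta_M^\phi)^{1/2}\chi_{[0,\pi]}\big((\Delta_M^\phi)^{1/2}\big)$ is the restriction of $(\Delta_M^\phi)^{1/2}$ to its spectral subspace for $[0,\pi]$. Its spectrum consists of at least $\nu_\phi=\#V_\phi$ eigenvalues counted with multiplicity (any further ones being equal to $\pi$), and $z_1^\phi\le\ldots\le z_{\nu_\phi}^\phi$ denote the first $\nu_\phi$ of them. *)

(* Defs.v *)
(* MathComp / MathComp-Analysis, with complex scalars R[i] from real-closed. *)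
From HB Require Import structures.
From mathcomp Require Import all_boot all_order all_algebra.
From mathcomp Require Import finmap.
From mathcomp Require Import all_classical all_reals all_analysis.
From mathcomp Require Import complex.
From Stdlib Require Import Relations.Relation_Operators.

Set Implicit Arguments.
Unset Strict Implicit.
Unset Printing Implicit Defensive.

Import Order.TTheory GRing.Theory Num.Theory.
Import numFieldNormedType.Exports.

Local Open Scope classical_set_scope.
Local Open Scope ring_scope.
Local Open Scope complex_scope.

(* The cardinality of a finite set; 0 on infinite sets. *)
Definition ncard (T : choiceType) (A : set T) : nat := #|` fset_set A|.

Section L2.
Variable R : realType.
Local Notation C := R[i].
Local Notation mu := (@lebesgue_measure R).

Definition cintegral (D : set R) (f : R -> C) : C :=
  (\int[mu]_(t in D) complex.Re (f t)) +i* (\int[mu]_(t in D) complex.Im (f t)).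

Definition cintegrable (D : set R) (f : R -> C) : Prop :=
  mu.-integrable D (fun t => (complex.Re (f t))%:E) /\
  mu.-integrable D (fun t => (complex.Im (f t))%:E).

(* f is absolutely continuous on [0,1] with derivative g a.e. *)
Definition ac_derivative (f g : R -> C) : Prop :=
  cintegrable `[0, 1] g /\
  forall t, t \in `[0, 1] -> f t = f 0 + cintegral `[0, t] g.

Definition real_L2 (f : R -> R) : Prop :=
  measurable_fun (`[0, 1] : set R) f /\
  mu.-integrable `[0, 1] (fun t => (f t ^+ 2)%:E).

Definition L2_01 (f : R -> C) : Prop :=
  real_L2 (fun t => complex.Re (f t)) /\ real_L2 (fun t => complex.Im (f t)).

End L2.

(* Metric graphs: the edge e is a copy of [0,1], running from [mg_end e false]
   (t = 0) to [mg_end e true] (t = 1).  The vertices and edges are subsets of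
   ambient types, so that a subgraph lives over the same types. *)
Record mgraph (T E : choiceType) := MGraph {
  mg_vert : set T;
  mg_edge : set E;
  mg_end : E -> bool -> T }.

Section Graphs.
Variables T E : choiceType.
Implicit Type G : mgraph T E.

(* Pairs (edge, end) at v: a loop at v occurs twice. *)
Definition ends_at G (v : T) : set (E * bool) :=
  [set x | mg_edge G x.1 /\ mg_end G x.1 x.2 = v].

Definition degree G (v : T) : nat := ncard (ends_at G v).

Definition connected_graph G : Prop :=
  forall u v, mg_vert G u -> mg_vert G v ->
    clos_refl_sym_trans T
      (fun a b => exists e, [/\ mg_edge G e, mg_end G e false = a
                              & mg_end G e true = b]) u v.

End Graphs.

Section Operators.
Variables (R : realType) (T E : choiceType).
Local Notation C := R[i].
Local Notation mu := (@lebesgue_measure R).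

(* A function on the graph; only its values on [0,1], on the edges of the
   graph, matter. *)
Definition gfun := E -> R -> C.

(* A possibly unbounded operator in L^2(G), given by its graph.  All operators
   below are compatible with [ae_eq_on G]. *)
Definition goper := gfun -> gfun -> Prop.

Implicit Types (G : mgraph T E) (A B : goper) (y w p q f : gfun).

Definition ae_eq_on G y f : Prop :=
  forall e, mg_edge G e -> {ae mu, forall t, t \in `[0, 1] -> y e t = f e t}.

(* For finite graphs, the only ones on which L2 and inner are used. *)
Definition L2 G y : Prop := forall e, mg_edge G e -> L2_01 (y e).

Definition inner G f y : C :=
  \sum_(e \in mg_edge G) cintegral `[0, 1] (fun t => f e t * (y e t)^*%C).

(* w is in H^2 of every edge, with first and second derivatives p and q. *)
Definition H2 G w p q : Prop :=
  (forall e, mg_edge G e ->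
     ac_derivative (w e) (p e) /\ ac_derivative (p e) (q e)) /\ L2 G q.

Definition continuous_at_vertices G w : Prop :=
  forall e e' (b b' : bool), mg_edge G e -> mg_edge G e' ->
    mg_end G e b = mg_end G e' b' -> w e b%:R = w e' b'%:R.

Definition vanishes_at G (v : T) w : Prop :=
  forall e (b : bool), mg_edge G e -> mg_end G e b = v -> w e b%:R = 0.

(* delta_e(v): +1 at the terminal end, -1 at the initial end. *)
Definition delta (b : bool) : C := if b then 1 else -1.

Definition kirchhoff_at G (v : T) p : Prop :=
  \sum_(x \in ends_at G v) delta x.2 * p x.1 (x.2)%:R = 0.

(* The metric Laplacian of G with Dirichlet conditions on the vertices in D and
   Kirchhoff conditions at the other vertices.  w is the continuous
   representative of y. *)
Definition metric_laplacian G (D : set T) : goper := fun y f =>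
  [/\ L2 G y, L2 G f &
   exists w p q,
     [/\ ae_eq_on G y w, H2 G w p q, continuous_at_vertices G w,
         (forall v, D v -> vanishes_at G v w) /\
         (forall v, mg_vert G v -> ~ D v -> kirchhoff_at G v p) &
         ae_eq_on G f (fun e t => - q e t)]].

(* (i d/dt + a_e) w, where p is the derivative of w. *)
Definition magnetic (a : E -> R) w p : gfun :=
  fun e t => 'i%C * p e t + (a e)%:C * w e t.

(* The operator (i d/dt + a_e)^2 with the matching Kirchhoff conditions; the
   derivative of [magnetic a w p] is [magnetic a p q]. *)
Definition magnetic_laplacian G (a : E -> R) : goper := fun y f =>
  [/\ L2 G y, L2 G f &
   exists w p q,
     [/\ ae_eq_on G y w, H2 G w p q, continuous_at_vertices G w,
         (forall v, mg_vert G v ->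
            kirchhoff_at G v (fun e t => p e t - 'i%C * (a e)%:C * w e t)) &
         ae_eq_on G f (magnetic a (magnetic a w p) (magnetic a p q))]].

Definition densely_defined G A : Prop :=
  forall h, L2 G h -> (forall y f, A y f -> inner G y h = 0) ->
    ae_eq_on G h (fun _ _ => 0).

(* A coincides with its adjoint, domains included. *)
Definition self_adjoint G A : Prop :=
  densely_defined G A /\
  forall y f, A y f <->
    [/\ L2 G y, L2 G f & forall u g, A u g -> inner G f u = inner G y g].

Definition nonnegative G A : Prop := forall y f, A y f -> 0 <= inner G f y.

(* B is the square root of A. *)
Definition is_sqrt G A B : Prop :=
  [/\ self_adjoint G B, nonnegative G B &
   forall y f, A y f <-> exists g, B y g /\ B g f].

Definition eigenvector A (m : R) y : Prop := A y (fun e t => m%:C * y e t).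

Definition lin_indep G (n : nat) (y : 'I_n -> gfun) : Prop :=
  forall c : 'I_n -> C,
    ae_eq_on G (fun e t => \sum_(j < n) c j * y j e t) (fun _ _ => 0) ->
    forall j, c j = 0.

(* The eigenvalues in P have total multiplicity at least n. *)
Definition mult_ge G A (P : R -> Prop) (n : nat) : Prop :=
  exists (m : 'I_n -> R) (y : 'I_n -> gfun),
    lin_indep G y /\ forall j, P (m j) /\ eigenvector A (m j) (y j).

(* l is the n-th (n >= 1) eigenvalue, in nondecreasing order and counted with
   multiplicity: N(< l) < n <= N(<= l), with N the eigenvalue counting
   function.  For given n there is at most one such l. *)
Definition nth_eigenvalue G A (n : nat) (l : R) : Prop :=
  mult_ge G A (fun m => m <= l) n /\ ~ mult_ge G A (fun m => m < l) n.

(* B restricted to its spectral subspace for P.  This is meant for a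
   self-adjoint B with discrete spectrum and bounded P, for which the range of
   the spectral projection is the (finite-dimensional) span of the eigenvectors
   with eigenvalue in P. *)
Definition spectral_restriction G B (P : R -> Prop) : goper := fun y f =>
  B y f /\
  exists (n : nat) (m : 'I_n -> R) (u : 'I_n -> gfun),
    (forall j, P (m j) /\ eigenvector B (m j) (u j)) /\
    ae_eq_on G y (fun e t => \sum_(j < n) u j e t).

(* W = sqrt(A) chi_[0,pi](sqrt(A)). *)
Definition is_sqrt_restricted_0pi G A (W : goper) : Prop :=
  exists B, is_sqrt G A B /\
    W = spectral_restriction G B (fun m => 0 <= m <= pi).

End Operators.

Section Periodic.
Variables (R : realType) (d : nat).
Local Notation C := R[i].
Local Notation pt := 'rV[R]_d.

Definition enorm (x : pt) : R := Num.sqrt (\sum_(j < d) x 0 j ^+ 2).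

(* Length of the restriction of the curve g to [a,b]. *)
Definition arc_length (g : R -> pt) (a b : R) : \bar R :=
  ereal_sup [set l | exists2 s, itv_partition a b s &
    l = (\sum_(0 <= k < size s)
           enorm (g (nth b (a :: s) k.+1) - g (nth b (a :: s) k)))%:E].

(* A Z^d-periodic equilateral graph in R^d.  An edge is an arc (or, for a loop,
   a closed curve) in R^d parametrized by its arc length t in [0,1]; two
   distinct edges meet at most in vertices.  The orientations given by the
   parametrizations are invariant under translations ([pg_periodicE]). *)
Record periodic_graph := PeriodicGraph {
  pg_vert : set pt;
  pg_edge : choiceType;
  pg_curve : pg_edge -> R -> pt;
  pg_basis : 'M[R]_d;   (* the rows are the periods a_1, ..., a_d *)
  pg_graph : mgraph pt pg_edge :=
    MGraph pg_vert setT (fun e b => pg_curve e b%:R);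
  pg_ends : forall e (b : bool), pg_vert (pg_curve e b%:R);
  pg_curve_cont : forall e, {within `[0, 1], continuous (pg_curve e)};
  pg_curve_vert : forall e t, 0 < t < 1 -> ~ pg_vert (pg_curve e t);
  pg_curve_inj : forall e e' t t', 0 < t < 1 -> 0 < t' < 1 ->
    pg_curve e t = pg_curve e' t' -> e = e' /\ t = t';
  pg_unit : forall e t, 0 <= t <= 1 ->
    arc_length (pg_curve e) 0 t = t%:E;
  pg_connected : connected_graph pg_graph;
  pg_infinite : infinite_set pg_vert;
  pg_locally_finite : forall r : R,
    finite_set [set v | pg_vert v /\ enorm v <= r];
  pg_degree_finite : forall v, pg_vert v -> finite_set (ends_at pg_graph v);
  pg_basisP : pg_basis \in unitmx;
  pg_periodicV : forall (s : 'I_d) v,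
    pg_vert v <-> pg_vert (v + row s pg_basis);
  pg_periodicE : forall (s : 'I_d) e,
    (exists e', forall t, 0 <= t <= 1 ->
       pg_curve e' t = pg_curve e t + row s pg_basis) /\
    (exists e', forall t, 0 <= t <= 1 ->
       pg_curve e' t = pg_curve e t - row s pg_basis) }.

Variable Gam : periodic_graph.
Local Notation E := (pg_edge Gam).

Definition coord (x : pt) : pt := x *m invmx (pg_basis Gam).

Definition translate (m : 'rV[int]_d) (x : pt) : pt :=
  x + map_mx (intr : int -> R) m *m pg_basis Gam.

(* The points with coordinates in [0,1)^d. *)
Definition cell : set pt := [set x | forall j, 0 <= coord x 0 j < 1].

(* The decomposition v = [v] + v~ with [v] in Z^d and v~ in the cell. *)
Definition int_part (x : pt) : 'rV[int]_d := map_mx Num.floor (coord x).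
Definition frac_part (x : pt) : pt := translate (- int_part x) x.

(* e' = e + m *)
Definition edge_translate (m : 'rV[int]_d) (e e' : E) : Prop :=
  forall t, 0 <= t <= 1 -> pg_curve e' t = translate m (pg_curve e t).

Definition VF : set pt := pg_vert Gam `&` cell.

(* The fundamental graph Gam / Z^d.  Vertices are represented in VF; each orbit
   of edges is represented by its unique member with initial vertex in VF. *)
Definition fundamental_graph : mgraph pt E :=
  MGraph VF [set e | cell (pg_curve e 0)]
    (fun e b => frac_part (pg_curve e b%:R)).

Definition edge_index (e : E) : 'rV[int]_d :=
  int_part (pg_curve e 1) - int_part (pg_curve e 0).

(* The Floquet operator, for theta in R^d representing a point of the torus. *)
Definition floquet (theta : 'rV[R]_d) : goper R E :=
  magnetic_laplacian fundamental_graph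
    (fun e => \sum_(j < d) (edge_index e 0 j)%:~R * theta 0 j).

(* The n-th band (n >= 1): the range over the torus of the n-th band function
   z_n >= 0, where z_n(theta)^2 is the n-th Floquet eigenvalue. *)
Definition band (n : nat) : set R :=
  [set z | exists theta, 0 <= z /\
     nth_eigenvalue fundamental_graph (floquet theta) n (z ^+ 2)].

Record fundamental_domain := FundamentalDomain {
  fd_vert : set pt;
  fd_edge : set E;
  fd_graph : mgraph pt E :=
    MGraph fd_vert fd_edge (fun e b => pg_curve e b%:R);
  fd_subV : fd_vert `<=` pg_vert Gam;
  fd_ends : forall e (b : bool), fd_edge e -> fd_vert (pg_curve e b%:R);
  fd_finiteV : finite_set fd_vert;
  fd_finiteE : finite_set fd_edge;
  fd_connected : connected_graph fd_graph;
  fd_VF : VF `<=` fd_vert;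
  fd_inequiv : forall e e' m, fd_edge e -> fd_edge e' ->
    edge_translate m e e' -> e = e';
  fd_coverV : forall v, pg_vert Gam v ->
    exists m u, fd_vert u /\ v = translate m u;
  fd_coverE : forall e', exists m e, fd_edge e /\ edge_translate m e e' }.

Variable G1 : fundamental_domain.

Definition inner_vertices : set pt :=
  [set v | fd_vert G1 v /\
           degree (pg_graph Gam) v = degree (fd_graph G1) v].

Definition boundary_vertices : set pt := fd_vert G1 `\` inner_vertices.

Definition neumann : goper R E := metric_laplacian (fd_graph G1) set0.

Definition dirichlet : goper R E :=
  metric_laplacian (fd_graph G1) boundary_vertices.

End Periodic.

(* Main.v *)
(** For [0 <= k < pi], an eigenfunction for the eigenvalue [k^2] is determined on
    each edge by its values at the two ends, and Kirchhoff's conditions become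
    the equation [x A = cos k x D] for the vertex values x, where A is the
    (magnetic) adjacency matrix and D the degree matrix, restricted to the
    vertices without a Dirichlet condition. Conversely, all solutions with
    [0 <= k <= pi] extend to eigenfunctions. As cos decreases on [0, pi], the
    n-th eigenvalue is [<= k^2] iff [A - cos k D] is nonnegative on a space of
    dimension n.

    Quasi-periodic extension embeds the functions on [V_F] into the functions on
    [V_1], and pulls back the Neumann forms of [Gamma_1] to the Floquet forms,
    because [Gamma_1] contains each orbit of edges once. Functions supported on
    the inner vertices are unchanged by this extension, so that the Dirichlet
    forms are restrictions of the Floquet forms. Restriction to the subspaces of
    codimension [nu_1 - nu] and [nu - nu_o] gives all inequalities. *)

Require Import Defs.
From mathcomp Require Import all_boot all_order all_algebra.
From mathcomp Require Import finmap.
From mathcomp Require Import all_classical all_reals all_analysis.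
From mathcomp Require Import complex.
From mathcomp Require Import measurable_realfun.
From mathcomp Require Import ring lra zify.

Set Implicit Arguments.
Unset Strict Implicit.
Unset Printing Implicit Defensive.

Import Order.TTheory GRing.Theory Num.Theory.
Import numFieldNormedType.Exports.

Local Open Scope classical_set_scope.
Local Open Scope ring_scope.
Local Open Scope sesquilinear_scope.

(** * Hermitian pencils *)

Section Pencil.
Variable C : numClosedFieldType.
Implicit Types (m n k : nat).

(** The delicate point is k = pi. There sin k = 0: a multiple of the sine can be added on an edge
    without changing the values at its ends, and pi may have a multiplicity beyond the number of
    vertices. Eigenfunctions are therefore translated into vectors only for k < pi. At k = pi the
    form A + D is a sum of squares over the edges, hence nonnegative on the whole space, and the
    form condition holds for every index up to the dimension without inspecting any eigenfunction.

    In the other direction vectors are lifted for all k in [0, pi]. When cos k is 1 or -1, an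
    eigenvector makes the corresponding sum of squares vanish, so an equality holds on every single
    edge; this is exactly the compatibility that lets a multiple of the cosine join the two end
    values.

    In this way each eigenvalue becomes the least k in [0, pi] that satisfies the form condition
    ([form_level]), and any comparison of eigenvalues is a transfer of subspaces. For a square root
    B of an operator A, self-adjointness and nonnegativity of B turn eigenvectors of A into
    eigenvectors of B. *)

Definition qform n (A : 'M[C]_n) (x : 'rV[C]_n) : C := (x *m A *m x ^t*) 0 0.

(* By the min-max principle, for Hermitian A and positive definite D: at least
   k eigenvalues l of the pencil [x A = l x D] are [>= c]. *)
Definition form_ge n (A D : 'M[C]_n) (c : C) k : Prop :=
  exists X : 'M[C]_n, (k <= \rank X)%N /\
    forall x : 'rV[C]_n, (x <= X)%MS -> c * qform D x <= qform A x.

Definition pencil_ge n (A D : 'M[C]_n) (P : C -> Prop) k : Prop :=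
  exists (l : 'I_k -> C) (X : 'M[C]_(k, n)), row_free X /\
    forall i, P (l i) /\ row i X *m A = l i *: (row i X *m D).

Lemma trmxC_mul m n p (A : 'M[C]_(m, n)) (B : 'M[C]_(n, p)) :
  (A *m B) ^t* = B ^t* *m A ^t*.
Proof. by rewrite trmx_mul map_mxM. Qed.

Lemma qform_congr m n (T : 'M[C]_(m, n)) (A : 'M[C]_n) (x : 'rV[C]_m) :
  qform (T *m A *m T ^t*) x = qform A (x *m T).
Proof. by rewrite /qform trmxC_mul !mulmxA. Qed.

(** The map [x -> x *m T] is injective and the forms on its source are pullbacks, so a good subspace
    is carried to a good subspace of the same dimension. *)
Lemma form_ge_congr m n (T : 'M[C]_(m, n)) A D c k : row_free T ->
  form_ge (T *m A *m T ^t*) (T *m D *m T ^t*) c k -> form_ge A D c k.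
Proof.
move=> Tfree [X [kX hX]]; exists <<X *m T>>%MS; split.
  by rewrite genmxE mxrankMfree.
move=> x; rewrite genmxE => /submxP[y ->].
by rewrite mulmxA -(qform_congr T A) -(qform_congr T D) hX ?submxMl.
Qed.

(** Dimension count: a subspace of dimension at least k meets the m-dimensional image of T in
    dimension at least k + m - n. *)
Lemma form_ge_restrict m n (T : 'M[C]_(m, n)) A D c k : row_free T ->
  form_ge A D c k ->
  form_ge (T *m A *m T ^t*) (T *m D *m T ^t*) c (k + m - n).
Proof.
move=> Tfree [X [kX hX]].
have /submxP[Z YE] : (X :&: T <= T)%MS by exact: capmxSr.
exists <<Z>>%MS; split.
  rewrite genmxE; apply: (@leq_trans (\rank (X :&: T)%MS)); last first.
    by rewrite YE mxrankM_maxl.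
  have := mxrank_sum_cap X T; rewrite (eqP Tfree).
  have := rank_leq_col (X + T)%MS; lia.
move=> x; rewrite genmxE => xZ; rewrite !qform_congr hX //.
by apply: (@submx_trans _ _ _ _ _ _ (Z *m T)); rewrite ?submxMr// -YE capmxSl.
Qed.

(* Congruence by [diag_mx (sqrt d)] turns D into the identity, so that the
   spectral theorem applies. *)
Lemma simultaneous_diagonalization n (A : 'M[C]_n) (d : 'rV[C]_n) :
  A ^t* = A -> (forall i, 0 < d 0 i) ->
  exists (T : 'M[C]_n) (l : 'rV[C]_n),
    [/\ T \in unitmx, forall i, l 0 i \is Num.real,
        A = T *m diag_mx l *m T ^t* & diag_mx d = T *m T ^t*].
Proof.
move=> Aherm dpos.
pose s := \row_i sqrtC (d 0 i); pose S := diag_mx s.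
have s0 i : 0 < s 0 i by rewrite mxE sqrtC_gt0.
have Sh : S ^t* = S.
  apply/matrixP => i j; rewrite !mxE eq_sym; case: eqVneq => [->|_].
    by rewrite !mulr1n geC0_conj// ltW//; have := s0 j; rewrite mxE.
  by rewrite !mulr0n conjC0.
have Su : S \in unitmx.
  rewrite unitmxE det_diag unitfE; apply/prodf_neq0 => i _.
  by rewrite lt0r_neq0.
have SS : S *m S = diag_mx d.
  rewrite mulmx_diag; congr diag_mx; apply/rowP => i.
  by rewrite !mxE -expr2 sqrtCK.
pose B := invmx S *m A *m invmx S.
have iSh : (invmx S) ^t* = invmx S by rewrite trmx_inv map_invmx Sh.
have Bh : B ^t* = B by rewrite /B !trmxC_mul iSh Aherm mulmxA.
have Bn : B \is normalmx by apply/normalmxP; rewrite Bh.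
have Bhs : B \is hermsymmx.
  by apply/is_hermitianmxP; rewrite expr0 scale1r Bh.
have BE := orthomx_spectralP Bn.
have Pu := spectral_unitarymx B.
pose P := spectralmx B; rewrite -/P in BE Pu.
exists (S *m P ^t*), (spectral_diag B); split.
- rewrite unitmx_mul Su map_unitmx unitmx_tr /=; exact: unitarymx_unit.
- have := hermitian_spectral_diag_real Bhs => /mxOverP h i; exact: h.
- have -> : A = S *m B *m S by rewrite /B !mulmxA mulmxV// mul1mx mulmxKV.
  by rewrite {1}BE invmx_unitary// trmxC_mul trmxCK Sh !mulmxA.
- rewrite trmxC_mul trmxCK Sh -SS -!mulmxA; congr (_ *m _).
  by rewrite !mulmxA -invmx_unitary// mulVmx ?mul1mx// unitarymx_unit.
Qed.

Lemma row_free_rowsub1 n p (f : 'I_p -> 'I_n) : injective f ->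
  row_free (rowsub f (1%:M : 'M[C]_n)).
Proof.
move=> finj; apply/row_freeP; exists (rowsub f (1%:M : 'M[C]_n))^T.
apply/matrixP => i j; rewrite !mxE; under eq_bigr do rewrite !mxE.
rewrite (bigD1 (f i))//= eqxx mul1r big1 ?addr0.
  by rewrite (inj_eq finj) eq_sym.
by move=> a ane; rewrite eq_sym (negPf ane) mul0r.
Qed.

Lemma qform_diag n (l x : 'rV[C]_n) :
  qform (diag_mx l) x = \sum_i l 0 i * `|x 0 i| ^+ 2.
Proof.
rewrite /qform mul_mx_diag mxE; apply: eq_bigr => i _.
by rewrite !mxE normCK mulrAC mulrC.
Qed.

Lemma qform1 n (x : 'rV[C]_n) : qform 1%:M x = \sum_i `|x 0 i| ^+ 2.
Proof.
rewrite -diag_const_mx qform_diag; apply: eq_bigr => i _.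
by rewrite mxE mul1r.
Qed.

Section Definite.
Variables (n : nat) (A : 'M[C]_n) (d : 'rV[C]_n).
Hypotheses (Aherm : A ^t* = A) (dpos : forall i, 0 < d 0 i).
Let D := diag_mx d.

(** Half of Courant-Fischer: with fewer than k diagonal entries [>= c], the given subspace would
    meet the span of the other coordinates, on which [A - c D] is negative definite. *)
Lemma form_ge_pencil (c : C) k : c \is Num.real ->
  form_ge A D c k -> pencil_ge A D (fun l => l \is Num.real /\ c <= l) k.
Proof.
move=> creal [X [kX hX]].
have [T [l [Tu lr AE DE]]] := simultaneous_diagonalization Aherm dpos.
pose I := [set i | c <= l 0 i]%SET.
have kI : (k <= #|I|)%N.
  rewrite leqNgt; apply/negP => Ik.
  have XT : \rank (X *m T) = \rank X by rewrite mxrankMfree// row_free_unit.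
  pose r : 'M[C]_(#|~: I|, n) := rowsub enum_val 1%:M.
  have /eqP rr : row_free r by apply: row_free_rowsub1; exact: enum_val_inj.
  have : (0 < \rank (X *m T :&: r)%MS)%N.
    have := mxrank_sum_cap (X *m T) r; have := rank_leq_col (X *m T + r)%MS.
    have := cardsC I; rewrite card_ord XT rr; lia.
  rewrite lt0n mxrank_eq0 => /rowV0Pn[x]; rewrite sub_capmx => /andP[xX xB] /negP; apply.
  have /submxP[y yE] := xX.
  have x0I i : i \in I -> x 0 i = 0.
    move=> iI; have /submxP[z ->] := xB; rewrite mxE big1// => a _; rewrite !mxE.
    case: eqP => [E|_]; last by rewrite mulr0.
    by have := enum_valP a; rewrite E inE iI.
  have := hX (y *m X) (submxMl _ _).
  rewrite AE /D DE -{1}[T]mulmx1 !qform_congr -mulmxA -yE qform1 qform_diag.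
  rewrite mulr_sumr -subr_ge0 -sumrB -oppr_le0 -sumrN => S0.
  have t0 i : 0 <= - (l 0 i * `|x 0 i| ^+ 2 - c * `|x 0 i| ^+ 2).
    rewrite -mulrBl -mulNr opprB; have [iI|iI] := boolP (i \in I).
      by rewrite x0I// normr0 expr0n mulr0.
    rewrite mulr_ge0 ?exprn_ge0// subr_ge0.
    by move: iI; rewrite inE -real_ltNge// => /ltW.
  (* All terms are nonnegative and their sum is nonpositive, so each vanishes; outside I the strict
     inequality between the diagonal entry and c then forces [x 0 i = 0]. *)
  have /psumr_eq0P E0 : \sum_i - (l 0 i * `|x 0 i| ^+ 2 - c * `|x 0 i| ^+ 2) = 0.
    by apply/le_anti; rewrite S0 sumr_ge0.
  apply/eqP/rowP => i; rewrite [RHS]mxE.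
  have [iI|iI] := boolP (i \in I); first exact: x0I.
  have /eqP := E0 (fun i _ => t0 i) i isT.
  rewrite -mulrBl -mulNr opprB mulf_eq0 subr_eq0 => /orP[/eqP cE|].
    by move: iI; rewrite inE cE lexx.
  by rewrite expf_eq0 normr_eq0 => /eqP.
(* Any k elements of I will do: row i of [invmx T] is an eigenvector of the pencil for [l 0 i]. *)
pose f (j : 'I_k) : 'I_n := enum_val (widen_ord kI j).
have finj : injective f by move=> i j /enum_val_inj/(congr1 val)/= /val_inj.
exists (fun j => l 0 (f j)), (rowsub f 1%:M *m invmx T); split.
  rewrite /row_free mxrankMfree ?row_free_unit ?unitmx_inv//.
  exact: row_free_rowsub1.
move=> i; split.
  by split=> //; have := enum_valP (widen_ord kI i); rewrite inE.
rewrite !row_mul row_rowsub row1 AE /D DE !mulmxA !mulmxKV// scalemxAl; congr (_ *m _).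
rewrite mul_mx_diag; apply/rowP => j; rewrite !mxE eqxx/=.
by case: eqP => [->|_]; rewrite mulrC ?mulr0 ?mul0r.
Qed.

(* In the coordinates [x *m T] of a simultaneous diagonalization, a row of
   eigenvalue l is supported where the diagonal entry is l. *)
Lemma pencil_coord (T : 'M[C]_n) (l : 'rV[C]_n) (x : 'rV[C]_n) (m : C) :
  T \in unitmx -> A = T *m diag_mx l *m T ^t* -> D = T *m T ^t* ->
  x *m A = m *: (x *m D) -> forall i, l 0 i != m -> (x *m T) 0 i = 0.
Proof.
move=> Tu -> -> xA i ne.
have Ttu : T ^t* \in unitmx by rewrite map_unitmx unitmx_tr.
have /rowP/(_ i) : x *m T *m diag_mx l = m *: (x *m T).
  apply: (can_inj (mulmxK Ttu)); rewrite -scalemxAl -!mulmxA.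
  by rewrite -!mulmxA in xA.
rewrite mul_mx_diag !mxE mulrC => /eqP; rewrite -subr_eq0 -mulrBl mulf_eq0 subr_eq0.
by rewrite (negPf ne) => /eqP.
Qed.

(** If a vector of the span is nonzero in coordinate i, so is one of the rows; by [pencil_coord] the
    diagonal entry [l 0 i] is then the eigenvalue of that row, hence [>= c]. *)
Lemma pencil_ge_form (c : C) k :
  pencil_ge A D (fun l => c <= l) k -> form_ge A D c k.
Proof.
move=> [m [X [Xf hX]]]; exists <<X>>%MS; split.
  by rewrite genmxE (eqP Xf).
have [T [l [Tu lr AE DE]]] := simultaneous_diagonalization Aherm dpos.
move=> x; rewrite genmxE => /submxP[y ->].
rewrite AE /D DE -{1}[T]mulmx1 !qform_congr -mulmxA qform1 qform_diag.
rewrite mulr_sumr; apply: ler_sum => i _.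
have [E|/eqP ne] := eqVneq ((y *m (X *m T)) 0 i) 0; first by rewrite E normr0 expr0n !mulr0.
rewrite ler_wpM2r ?exprn_ge0//.
have [j jne] : exists j, (X *m T) j i != 0.
  apply/existsP; apply: contraT => /existsPn h; case: ne.
  by rewrite mxE big1// => a _; have := h a; rewrite negbK => /eqP ->; rewrite mulr0.
have [cm xA] := hX j.
have [->//|mne] := eqVneq (l 0 i) (m j).
by case/eqP: jne; have := pencil_coord Tu AE DE xA mne; rewrite -row_mul mxE.
Qed.

(** A linear relation splits into one relation per eigenvalue, because coordinate i of [x *m T] sees
    only the eigenvalue [l 0 i]. *)
Lemma pencil_separate k (m : 'I_k -> C) (X : 'I_k -> 'rV[C]_n) (r : 'I_k -> C) :
  (forall j, X j *m A = m j *: (X j *m D)) ->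
  \sum_j r j *: X j = 0 -> forall l, \sum_(j | m j == l) r j *: X j = 0.
Proof.
move=> hX S0 l0.
have [T [l [Tu lr AE DE]]] := simultaneous_diagonalization Aherm dpos.
apply: (can_inj (mulmxK Tu)); rewrite mul0mx mulmx_suml; apply/rowP => i.
rewrite [RHS]mxE summxE.
have coord j : l 0 i != m j -> (r j *: X j *m T) 0 i = 0.
  by move=> ne; rewrite -scalemxAl mxE (pencil_coord Tu AE DE (hX j) ne) mulr0.
have [E|ne] := eqVneq (l 0 i) l0; last first.
  by rewrite big1// => j /eqP mj; rewrite coord// mj.
have /rowP/(_ i) : (\sum_j r j *: X j) *m T = 0 by rewrite S0 mul0mx.
rewrite mulmx_suml summxE mxE (bigID (fun j => m j == l0))/=.
by rewrite [X in _ + X]big1 ?addr0// => j ne; rewrite coord// E eq_sym.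
Qed.

End Definite.

End Pencil.

(** * The differential equation on an edge *)

Section UnitInterval.
Variable R : realType.
Local Notation mu := (@lebesgue_measure R).
Implicit Types (f g h : R -> R) (t : R).

Definition real_ac_derivative f g : Prop :=
  mu.-integrable `[0, 1] (EFin \o g) /\
  forall t, t \in `[0, 1] -> f t = f 0 + \int[mu]_(s in `[0, t]) g s.

Lemma continuous_integrable01 f : {within `[0, 1], continuous f} ->
  mu.-integrable `[0, 1] (EFin \o f).
Proof. by move=> fc; apply: continuous_compact_integrable => //; exact: segment_compact. Qed.

Lemma continuous_real_L2 f : {within `[0, 1], continuous f} -> real_L2 f.
Proof.
move=> fc; split.
  by apply: subspace_continuous_measurable_fun => //; exact: measurable_itv.
apply: (@continuous_integrable01 (fun t => f t ^+ 2)).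
by move=> t; apply: continuousM; exact: fc.
Qed.

Lemma within_continuous_eq01 f g : (forall t, t \in `[0, 1] -> f t = g t) ->
  {within `[0, 1], continuous f} -> {within `[0, 1], continuous g}.
Proof.
move=> fg fc; apply: (subspace_eq_continuous _ fc) => t; rewrite inE /= => t01.
exact: fg.
Qed.

Lemma real_ac_derivative_continuous f g : real_ac_derivative f g ->
  {within `[0, 1], continuous f}.
Proof.
move=> [gi fE]; apply: (@within_continuous_eq01 (fun t => f 0 + \int[mu]_(s in `[0, t]) g s)).
  by move=> t /fE.
move=> t; apply: cvgD; first exact: cvg_cst.
exact: (@parameterized_integral_continuous _ 0 1 g ler01 gi).
Qed.

Lemma real_ac_derivative_is_derive f g : real_ac_derivative f g ->
  {within `[0, 1], continuous g} -> forall t, 0 < t < 1 -> is_derive t (1 : R) f (g t).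
Proof.
move=> [gi fE] gc t /andP[t0 t1].
have gt : {for t, continuous g}.
  have [h _ _] := (continuous_within_itvP g ltr01).1 gc.
  by apply: h; rewrite in_itv/= t0 t1.
have [dF FE] := @continuous_FTC1_closed R g 0 t 1 t1 gi t0 gt.
pose F x : R := \int[mu]_(s in `[0, x]) g s.
have FF : is_derive t (1 : R) (fun x => f 0 + F x) (g t).
  rewrite -[g t]add0r; apply: is_deriveD.
  by rewrite -FE derive1E; exact: DeriveDef.
have near_eq : \forall x \near t, f 0 + F x = f x.
  near=> x; rewrite -fE//; rewrite in_itv/=; apply/andP; split; near: x.
    exact: lt_le_nbhsr.
  exact: lt_le_nbhsl.
exact: (near_eq_is_derive near_eq FF).
Unshelve. all: by end_near. Qed.

(** This is the regularity step: a derivative known almost everywhere is traded for a continuous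
    one, which is then a classical derivative inside the interval. *)
Lemma real_ac_derivative_ae f g h : real_ac_derivative f g ->
  {ae mu, forall t, t \in `[0, 1] -> g t = h t} -> {within `[0, 1], continuous h} ->
  real_ac_derivative f h.
Proof.
move=> [gi fE] gh hc; have hi := continuous_integrable01 hc; split => // t t01.
rewrite fE//; congr (_ + fine _).
have sub : `[0, t] `<=` `[0, 1].
  by move: t01; rewrite in_itv/= => /andP[_ t1]; apply: subset_itvl; rewrite bnd_simp.
apply: ae_eq_integral => //.
- by apply: measurable_funS sub _ => //; exact: measurable_int gi.
- by apply: measurable_funS sub _ => //; exact: measurable_int hi.
- apply: (@filterS _ _ (ae_filter_ringOfSetsType mu) _ _ _ gh) => x gx /sub/= x01.
  by rewrite gx.
Qed.

Lemma is_derive_real_ac_derivative f g : (forall t, is_derive t (1 : R) f (g t)) ->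
  continuous g -> real_ac_derivative f g.
Proof.
move=> df gc; split; first exact/continuous_integrable01/continuous_subspaceT.
move=> t; rewrite in_itv/= => /andP[]; rewrite le_eqVlt => /predU1P[<- _|t0 _].
  by rewrite set_itv1 Rintegral_set1 addr0.
rewrite /Rintegral (@continuous_FTC2 _ g f 0 t t0); first by rewrite /= subrKC.
- exact: continuous_subspaceT.
- have fc x : {for x, continuous f}.
    by apply: differentiable_continuous; apply/derivable1_diffP; have [] := df x.
  split; first by move=> x _; have [] := df x.
    by apply: cvg_at_right_filter; exact: fc.
  by apply: cvg_at_left_filter; exact: fc.
- by move=> x _; rewrite derive1E; exact: derive_val.
Qed.

Lemma constant01 f : {within `[0, 1], continuous f} ->
  (forall t, 0 < t < 1 -> is_derive t (1 : R) f 0) ->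
  forall t, t \in `[0, 1] -> f t = f 0.
Proof.
move=> fc df t; rewrite in_itv/= => /andP[]; rewrite le_eqVlt => /predU1P[<- //|t0 t1].
have [] := @MVT R f (cst 0) 0 t t0.
- move=> x; rewrite in_itv/= => /andP[x0 xt]; apply: df.
  by rewrite x0 (lt_le_trans xt t1).
- by apply: continuous_subspaceW fc; apply: subset_itvl; rewrite bnd_simp.
by move=> c _ /eqP; rewrite mul0r subr_eq0 => /eqP.
Qed.

(** Functions that differ at t differ on a ball around t, which has positive measure. *)
Lemma ae_eq_continuous01 f g : {within `[0, 1], continuous f} ->
  {within `[0, 1], continuous g} ->
  {ae mu, forall t, t \in `[0, 1] -> f t = g t} ->
  forall t, 0 < t < 1 -> f t = g t.
Proof.
move=> fc gc fg t /andP[t0 t1]; apply/eqP; apply: contraT => ne.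
have t01 : t \in `]0, 1[ by rewrite in_itv/= t0 t1.
have [/(_ t) fct _ _] := (continuous_within_itvP f ltr01).1 fc.
have [/(_ t) gct _ _] := (continuous_within_itvP g ltr01).1 gc.
have hc : {for t, continuous (fun x => f x - g x)}.
  by apply: continuousB; [exact: fct|exact: gct].
have : \forall x \near t, (f x - g x != 0) && (x \in `[0, 1]).
  have h1 : \forall x \near t, f x - g x != 0.
    by apply: (cvgr_neq0 _ hc); rewrite subr_eq0.
  near=> x; apply/andP; split; first by near: x.
  rewrite in_itv/=; apply/andP; split; apply: ltW; near: x.
    exact: lt_nbhsr.
  exact: lt_nbhsl.
move=> /nbhs_ballP[e /= e0 be].
have [N [mN N0 sub]] := fg.
have : (mu (ball t e) <= mu N)%E.
  apply: le_measure; rewrite ?inE//; first exact: measurable_ball.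
  move=> x /be/andP[fgx x01]; apply: sub => /= /(_ x01) E.
  by move: fgx; rewrite E subrr eqxx.
rewrite (_ : mu (ball t e) = (e *+ 2)%:E); last first.
  by rewrite lebesgue_measure_ball// ltW.
move=> h; have : (0 < (e *+ 2)%:E)%E by rewrite lte_fin pmulrn_lgt0.
by rewrite ltNge (le_trans h)// N0.
Unshelve. all: by end_near. Qed.

End UnitInterval.

(** * Every solution on an edge is given by its initial data *)

Section EdgeEquation.
Variable R : realType.
Local Notation C := R[i].
Local Notation mu := (@lebesgue_measure R).
Local Open Scope complex_scope.
Implicit Types (a m t : R) (w p q : R -> C).

(* The fundamental system of [u'' = - m u]. *)
Definition fundamental_pair m (c s : R -> R) : Prop :=
  [/\ c 0 = 1, s 0 = 0, forall t, is_derive t (1 : R) c (- m * s t) &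
      forall t, is_derive t (1 : R) s (c t)].

Lemma is_derive_continuous (f g : R -> R) :
  (forall t, is_derive t (1 : R) f (g t)) -> continuous f.
Proof.
move=> df t; apply: differentiable_continuous; apply/derivable1_diffP.
by have [] := df t.
Qed.

Lemma fundamental_pair_wronskian m c s : fundamental_pair m c s ->
  forall t, c t ^+ 2 + m * s t ^+ 2 = 1.
Proof.
move=> [c0 s0 dc ds] t.
have h x : is_derive x (1 : R) (fun t => c t * c t + m * (s t * s t)) 0.
  by apply: is_derive_eq; rewrite /GRing.scale/=; ring.
have := is_derive_0_is_cst t 0 h; rewrite c0 s0 !expr2 => ->; ring.
Qed.

Lemma ode_uniqueness m c s (u v : R -> R) : fundamental_pair m c s ->
  {within `[0, 1], continuous u} -> {within `[0, 1], continuous v} ->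
  (forall t, 0 < t < 1 -> is_derive t (1 : R) u (v t)) ->
  (forall t, 0 < t < 1 -> is_derive t (1 : R) v (- m * u t)) ->
  forall t, t \in `[0, 1] ->
    u t = u 0 * c t + v 0 * s t /\ v t = - m * u 0 * s t + v 0 * c t.
Proof.
move=> fcs uc vc du dv t t01; have W := fundamental_pair_wronskian fcs t.
have [c0 s0 dc ds] := fcs.
have cc : {within `[0, 1], continuous c} by exact/continuous_subspaceT/is_derive_continuous.
have sc : {within `[0, 1], continuous s} by exact/continuous_subspaceT/is_derive_continuous.
(* The constant expressions in E1 and E2 result from applying the inverse of the fundamental matrix
   to (u, v); its determinant is 1 by the Wronskian identity. *)
have E1 : u t * c t - v t * s t = u 0.
  have := @constant01 R (fun t => u t * c t - v t * s t) _ _ t t01.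
  rewrite c0 s0 mulr1 mulr0 subr0; apply.
    move=> x; apply: cvgB; apply: cvgM; [exact: uc|exact: cc|exact: vc|exact: sc].
  move=> x x01; have dux := du x x01; have dvx := dv x x01.
  by apply: is_derive_eq; rewrite /GRing.scale/=; ring.
have E2 : m * u t * s t + v t * c t = v 0.
  have := @constant01 R (fun t => m * u t * s t + v t * c t) _ _ t t01.
  rewrite c0 s0 mulr1 mulr0 add0r; apply.
    move=> x; apply: cvgD; apply: cvgM; [|exact: sc|exact: vc|exact: cc].
    by apply: cvgM; [exact: cvg_cst|exact: uc].
  move=> x x01; have dux := du x x01; have dvx := dv x x01.
  by apply: is_derive_eq; rewrite /GRing.scale/=; ring.
rewrite -E1 -E2; split.
  rewrite -[LHS]mulr1 -W; ring.
rewrite -[LHS]mulr1 -W; ring.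
Qed.

Definition cis a : C := cos a +i* sin a.

Lemma cisD a b : cis (a + b) = cis a * cis b.
Proof. by rewrite /cis cosD sinD; apply/eqP; rewrite eq_complex/= eqxx/= addrC. Qed.

Lemma cis0 : cis 0 = 1.
Proof. by rewrite /cis cos0 sin0. Qed.

Lemma cis_conj a : (cis a)^* = cis (- a).
Proof. by rewrite /cis cosN sinN. Qed.

Lemma cisMN a : cis a * cis (- a) = 1.
Proof. by rewrite -cisD subrr cis0. Qed.

Lemma ac_derivativeP w p : ac_derivative w p <->
  real_ac_derivative (fun t => complex.Re (w t)) (fun t => complex.Re (p t)) /\
  real_ac_derivative (fun t => complex.Im (w t)) (fun t => complex.Im (p t)).
Proof.
split=> [[[ri ii] wE]|[[ri rE] [ii iE]]].
  by split; split=> // t /wE ->; case: (w 0).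
split=> // t t01; have := rE t t01; have := iE t t01.
by case: (w t) (w 0) => [x y] [x0 y0]/= -> ->.
Qed.

(** The equation determines q only almost everywhere, but it expresses q through the continuous
    functions w and p. So p is continuously differentiable inside the edge, and the gauge factor
    [cis (a * t)] reduces the problem to [u'' = - m u]. *)
Lemma edge_solution a m c s w p q : fundamental_pair m c s ->
  ac_derivative w p -> ac_derivative p q ->
  {ae mu, forall t, t \in `[0, 1] ->
    'i * ('i * q t + a%:C * p t) + a%:C * ('i * p t + a%:C * w t) = m%:C * w t} ->
  forall t, t \in `[0, 1] ->
    w t = cis (a * t) * (w 0 * (c t)%:C + (p 0 - 'i * a%:C * w 0) * (s t)%:C) /\
    p t - 'i * a%:C * w t =
      cis (a * t) * (- (m%:C * w 0) * (s t)%:C + (p 0 - 'i * a%:C * w 0) * (c t)%:C).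
Proof.
move=> fcs /ac_derivativeP[xd yd] /ac_derivativeP[xd' yd'] qae t t01.
set x := fun t => complex.Re (w t) in xd; set y := fun t => complex.Im (w t) in yd.
set x1 := fun t => complex.Re (p t) in xd xd'; set y1 := fun t => complex.Im (p t) in yd yd'.
have xc := real_ac_derivative_continuous xd; have yc := real_ac_derivative_continuous yd.
have x1c := real_ac_derivative_continuous xd'; have y1c := real_ac_derivative_continuous yd'.
(* Real and imaginary part of [2 i a p + (a^2 - m) w], the value of q obtained by solving the
   equation. *)
pose x2 t := - 2 * a * y1 t + (a ^+ 2 - m) * x t.
pose y2 t := 2 * a * x1 t + (a ^+ 2 - m) * y t.
have x2c : {within `[0, 1], continuous x2}.
  by move=> z; apply: cvgD; apply: cvgM; [exact: cvg_cst|exact: y1c|exact: cvg_cst|exact: xc].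
have y2c : {within `[0, 1], continuous y2}.
  by move=> z; apply: cvgD; apply: cvgM; [exact: cvg_cst|exact: x1c|exact: cvg_cst|exact: yc].
have {}xd' : real_ac_derivative x1 x2.
  apply: (real_ac_derivative_ae xd') x2c.
  apply: (@filterS _ _ (ae_filter_ringOfSetsType mu) _ _ _ qae) => z E z01; move: (E z01).
  rewrite /x2 /x /y1; case: (q z) (p z) (w z) => [q1 q2] [p1 p2] [w1 w2].
  by move/eqP; rewrite eq_complex/= => /andP[/eqP h _]; lra.
have {}yd' : real_ac_derivative y1 y2.
  apply: (real_ac_derivative_ae yd') y2c.
  apply: (@filterS _ _ (ae_filter_ringOfSetsType mu) _ _ _ qae) => z E z01; move: (E z01).
  rewrite /y2 /y /x1; case: (q z) (p z) (w z) => [q1 q2] [p1 p2] [w1 w2].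
  by move/eqP; rewrite eq_complex/= => /andP[_ /eqP h]; lra.
have dx := real_ac_derivative_is_derive xd x1c.
have dy := real_ac_derivative_is_derive yd y1c.
have dx1 := real_ac_derivative_is_derive xd' x2c.
have dy1 := real_ac_derivative_is_derive yd' y2c.
have dcos z : is_derive z (1 : R) (fun t => cos (a * t)) (- a * sin (a * z)).
  by apply: is_derive_eq; rewrite /GRing.scale/=; ring.
have dsin z : is_derive z (1 : R) (fun t => sin (a * t)) (a * cos (a * z)).
  by apply: is_derive_eq; rewrite /GRing.scale/=; ring.
have cc : {within `[0, 1], continuous (fun t => cos (a * t))}.
  by apply: continuous_subspaceT; apply: is_derive_continuous dcos.
have sc : {within `[0, 1], continuous (fun t => sin (a * t))}.
  by apply: continuous_subspaceT; apply: is_derive_continuous dsin.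
(* [u1 + i u2 = e^(-iat) w] and [v1 + i v2 = e^(-iat) (p - i a w)]: both
   components solve [u'' = - m u]. *)
pose u1 t := x t * cos (a * t) + y t * sin (a * t).
pose u2 t := y t * cos (a * t) - x t * sin (a * t).
pose v1 t := (x1 t + a * y t) * cos (a * t) + (y1 t - a * x t) * sin (a * t).
pose v2 t := (y1 t - a * x t) * cos (a * t) - (x1 t + a * y t) * sin (a * t).
have rc : {within `[0, 1], continuous (fun t => x1 t + a * y t)}.
  by move=> z; apply: cvgD; [exact: x1c|apply: cvgM; [exact: cvg_cst|exact: yc]].
have ic : {within `[0, 1], continuous (fun t => y1 t - a * x t)}.
  by move=> z; apply: cvgB; [exact: y1c|apply: cvgM; [exact: cvg_cst|exact: xc]].
have [||||E1 E1'] := @ode_uniqueness m c s u1 v1 fcs _ _ _ _ t t01.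
- by move=> z; apply: cvgD; apply: cvgM; [exact: xc|exact: cc|exact: yc|exact: sc].
- by move=> z; apply: cvgD; apply: cvgM; [exact: rc|exact: cc|exact: ic|exact: sc].
- move=> z z01; have dxz := dx z z01; have dyz := dy z z01.
  by apply: is_derive_eq; rewrite /GRing.scale/= /v1; ring.
- move=> z z01; have dxz := dx z z01; have dyz := dy z z01.
  have dx1z := dx1 z z01; have dy1z := dy1 z z01.
  by apply: is_derive_eq; rewrite /GRing.scale/= /u1 /x2 /y2; ring.
have [||||E2 E2'] := @ode_uniqueness m c s u2 v2 fcs _ _ _ _ t t01.
- by move=> z; apply: cvgB; apply: cvgM; [exact: yc|exact: cc|exact: xc|exact: sc].
- by move=> z; apply: cvgB; apply: cvgM; [exact: ic|exact: cc|exact: rc|exact: sc].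
- move=> z z01; have dxz := dx z z01; have dyz := dy z z01.
  by apply: is_derive_eq; rewrite /GRing.scale/= /v2; ring.
- move=> z z01; have dxz := dx z z01; have dyz := dy z z01.
  have dx1z := dx1 z z01; have dy1z := dy1 z z01.
  by apply: is_derive_eq; rewrite /GRing.scale/= /u2 /x2 /y2; ring.
have u10 : u1 0 = x 0 by rewrite /u1 mulr0 cos0 sin0; ring.
have u20 : u2 0 = y 0 by rewrite /u2 mulr0 cos0 sin0; ring.
have v10 : v1 0 = x1 0 + a * y 0 by rewrite /v1 mulr0 cos0 sin0; ring.
have v20 : v2 0 = y1 0 - a * x 0 by rewrite /v2 mulr0 cos0 sin0; ring.
rewrite u10 v10 in E1 E1'; rewrite u20 v20 in E2 E2'.
have wE : w t = cis (a * t) * (u1 t +i* u2 t).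
  have CS := cos2Dsin2 (a * t).
  rewrite [LHS](_ : _ = x t +i* y t); last by rewrite /x /y; case: (w t).
  apply/eqP; rewrite eq_complex/= /u1 /u2; apply/andP; split; apply/eqP.
    rewrite -[LHS]mulr1 -CS; ring.
  rewrite -[LHS]mulr1 -CS; ring.
have rE : p t - 'i * a%:C * w t = cis (a * t) * (v1 t +i* v2 t).
  have CS := cos2Dsin2 (a * t).
  rewrite [LHS](_ : _ = (x1 t + a * y t) +i* (y1 t - a * x t)); last first.
    rewrite /x /y /x1 /y1; case: (w t) (p t) => [? ?] [? ?]; apply/eqP; rewrite eq_complex/=.
    by apply/andP; split; apply/eqP; ring.
  apply/eqP; rewrite eq_complex/= /v1 /v2; apply/andP; split; apply/eqP.
    rewrite -[LHS]mulr1 -CS; ring.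
  rewrite -[LHS]mulr1 -CS; ring.
split; [rewrite wE|rewrite rE]; congr (_ * _); rewrite ?E1 ?E2 ?E1' ?E2' /x /y /x1 /y1.
  case: (w 0) (p 0) => [? ?] [? ?]; apply/eqP; rewrite eq_complex/=.
  by apply/andP; split; apply/eqP; ring.
case: (w 0) (p 0) => [? ?] [? ?]; apply/eqP; rewrite eq_complex/=.
by apply/andP; split; apply/eqP; ring.
Qed.

End EdgeEquation.

(** * Explicit solutions with prescribed values at the two ends *)

Section ExplicitSolutions.
Variable R : realType.
Local Notation C := R[i].
Local Open Scope complex_scope.
Implicit Types (a k m t : R) (f g w p q : R -> C).

(** The bound [k < pi] keeps [s 1] away from 0: it is sin k / k, or 1 when k = 0. A solution is then
    determined by its end values. *)
Lemma fundamental_pair_trig k : 0 <= k < pi ->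
  exists c s, [/\ fundamental_pair (k ^+ 2) c s, c 1 = cos k & s 1 != 0].
Proof.
move=> /andP[]; rewrite le_eqVlt => /predU1P[<- _|k0 kpi].
  exists (cst 1), id; split; rewrite ?cos0 ?oner_neq0//; split=> // t.
    by rewrite expr0n oppr0 mul0r; exact: is_derive_cst.
  exact: is_derive_id.
have kN : k != 0 by rewrite gt_eqF.
exists (fun t => cos (k * t)), (fun t => sin (k * t) / k); split.
- split; rewrite ?mulr0 ?cos0 ?sin0 ?mul0r// => t.
    by apply: is_derive_eq; rewrite /GRing.scale/=; field.
  by apply: is_derive_eq; rewrite /GRing.scale/=; field.
- by rewrite mulr1.
- by rewrite mulr1 mulf_neq0 ?invr_eq0// gt_eqF// sin_gt0_pi// k0.
Qed.

(** The value cosh > 1 at the end will exclude negative eigenvalues, as the eigenvalues of the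
    pencil lie in [-1, 1]. *)
Lemma fundamental_pair_hyperbolic m : m < 0 ->
  exists c s, [/\ fundamental_pair m c s, 1 < c 1 & s 1 != 0].
Proof.
move=> m0; pose k := Num.sqrt (- m).
have mk : m = - k ^+ 2 by rewrite sqr_sqrtr ?opprK// oppr_ge0 ltW.
have k0 : 0 < k by rewrite sqrtr_gt0 oppr_gt0.
have kN : k != 0 by rewrite gt_eqF.
have e1 : 1 < expR k by rewrite expR_gt1.
have eN : expR k * expR (- k) = 1 by rewrite -expRD subrr expR0.
have e0 := expR_gt0 (- k).
exists (fun t => (expR (k * t) + expR (- k * t)) / 2).
exists (fun t => (expR (k * t) - expR (- k * t)) / (2 * k)); split.
- rewrite mk; split; rewrite ?mulr0 ?expR0 ?subrr ?mul0r//; first by field.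
    by move=> t; apply: is_derive_eq; rewrite /GRing.scale/=; field.
  by move=> t; apply: is_derive_eq; rewrite /GRing.scale/=; field.
- by rewrite !mulr1; nra.
- rewrite !mulr1 mulf_neq0 ?invr_eq0 ?mulf_neq0//.
  by rewrite gt_eqF// subr_gt0 ltr_expR; lra.
Qed.

Definition is_cderive f g : Prop := forall t,
  is_derive t (1 : R) (fun t => complex.Re (f t)) (complex.Re (g t)) /\
  is_derive t (1 : R) (fun t => complex.Im (f t)) (complex.Im (g t)).

Definition ccontinuous f : Prop :=
  continuous (fun t => complex.Re (f t)) /\ continuous (fun t => complex.Im (f t)).

Lemma is_cderive_ccontinuous f g : is_cderive f g -> ccontinuous f.
Proof. by move=> h; split; apply: is_derive_continuous => t; have [] := h t; eauto. Qed.

Lemma is_cderive_ext f g h : is_cderive f g -> (forall t, g t = h t) -> is_cderive f h.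
Proof. by move=> fg gh t; rewrite -gh; exact: fg. Qed.

Lemma is_cderive_ac f g : is_cderive f g -> ccontinuous g -> ac_derivative f g.
Proof.
move=> fg [rc ic]; apply/ac_derivativeP; split; apply: is_derive_real_ac_derivative => // t;
  by have [] := fg t.
Qed.

Lemma ccontinuous_L2 f : ccontinuous f -> L2_01 f.
Proof. by move=> [rc ic]; split; apply: continuous_real_L2; exact: continuous_subspaceT. Qed.

Lemma ccontinuousZ (z : C) f : ccontinuous f -> ccontinuous (fun t => z * f t).
Proof.
move=> [fr fi]; split.
  have -> : (fun t => complex.Re (z * f t)) =
      (fun t => complex.Re z * complex.Re (f t) - complex.Im z * complex.Im (f t)).
    by apply/funext => x; case: (f x) => [? ?]; case: (z).
  move=> t; apply: cvgB; apply: cvgM; [exact: cvg_cst|exact: fr|exact: cvg_cst|exact: fi].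
have -> : (fun t => complex.Im (z * f t)) =
    (fun t => complex.Re z * complex.Im (f t) + complex.Im z * complex.Re (f t)).
  by apply/funext => x; case: (f x) => [? ?]; case: (z).
move=> t; apply: cvgD; apply: cvgM; [exact: cvg_cst|exact: fi|exact: cvg_cst|exact: fr].
Qed.

Lemma ccontinuous_sum n (f : 'I_n -> R -> C) : (forall j, ccontinuous (f j)) ->
  ccontinuous (fun t => \sum_j f j t).
Proof.
have sumc (g : 'I_n -> R -> R) : (forall j, continuous (g j)) -> continuous (fun t => \sum_j g j t).
  elim: n {f} g => [|n IH] g gc.
    by under eq_fun do rewrite big_ord0; exact: cst_continuous.
  under eq_fun do rewrite big_ord_recr /=.
  by move=> t; apply: cvgD; [apply: IH => j; exact: gc|exact: gc].
move=> fc; split.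
  have -> : (fun t => complex.Re (\sum_j f j t)) = (fun t => \sum_j complex.Re (f j t)).
    by apply/funext => t; rewrite raddf_sum.
  by apply: sumc => j; exact: (fc j).1.
have -> : (fun t => complex.Im (\sum_j f j t)) = (fun t => \sum_j complex.Im (f j t)).
  by apply/funext => t; rewrite raddf_sum.
by apply: sumc => j; exact: (fc j).2.
Qed.

(** One-sided limits carry the equality from the open interval to the ends, where vertex values are
    read off. *)
Lemma ccontinuous_ae_eq0 f : ccontinuous f ->
  {ae @lebesgue_measure R, forall t, t \in `[0, 1] -> f t = 0} -> f 0 = 0 /\ f 1 = 0.
Proof.
move=> [rc ic] f0.
have h (g : R -> R) : continuous g ->
    {ae @lebesgue_measure R, forall t, t \in `[0, 1] -> g t = 0} -> g 0 = 0 /\ g 1 = 0.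
  move=> gc g0.
  have cc : {within `[0, 1], continuous (cst 0 : R -> R)}.
    by apply: continuous_subspaceT; exact: cst_continuous.
  have {}g0 := ae_eq_continuous01 (continuous_subspaceT gc) cc g0.
  split.
    have g1 : g x @[x --> 0^'+] --> g 0 by apply: cvg_at_right_filter; exact: gc.
    have g2 : g x @[x --> 0^'+] --> (0 : R).
      apply: (@cvg_trans _ (cst (0 : R) @ 0^'+)); last exact: cvg_cst.
    apply: near_eq_cvg; near=> x; symmetry; apply: g0.
      by apply/andP; split; near: x; [exact: nbhs_right_gt|exact: nbhs_right_lt].
    exact: cvg_unique g1 g2.
  have g1 : g x @[x --> 1^'-] --> g 1 by apply: cvg_at_left_filter; exact: gc.
  have g2 : g x @[x --> 1^'-] --> (0 : R).
    apply: (@cvg_trans _ (cst (0 : R) @ 1^'-)); last exact: cvg_cst.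
    apply: near_eq_cvg; near=> x; symmetry; apply: g0.
    by apply/andP; split; near: x; [exact: nbhs_left_gt|exact: nbhs_left_lt].
  exact: cvg_unique g1 g2.
have r0 : {ae @lebesgue_measure R, forall t, t \in `[0, 1] -> complex.Re (f t) = 0}.
  apply: (@filterS _ _ (ae_filter_ringOfSetsType (@lebesgue_measure R)) _ _ _ f0) => t ft t01.
  by rewrite ft.
have i0 : {ae @lebesgue_measure R, forall t, t \in `[0, 1] -> complex.Im (f t) = 0}.
  apply: (@filterS _ _ (ae_filter_ringOfSetsType (@lebesgue_measure R)) _ _ _ f0) => t ft t01.
  by rewrite ft.
have [r0' r1'] := h _ rc r0; have [i0' i1'] := h _ ic i0.
by split; apply/eqP; rewrite eq_complex/= ?r0' ?i0' ?r1' ?i1' eqxx.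
Unshelve. all: by end_near. Qed.

Lemma is_cderive_cst (z : C) : is_cderive (fun=> z) (fun=> 0).
Proof. by move=> t; split; apply: is_derive_cst. Qed.

Lemma is_cderiveD f g f1 g1 : is_cderive f f1 -> is_cderive g g1 ->
  is_cderive (fun t => f t + g t) (fun t => f1 t + g1 t).
Proof.
move=> hf hg t; have [fr fi] := hf t; have [gr gi] := hg t; split.
  have -> : (fun t => complex.Re (f t + g t)) = (fun t => complex.Re (f t) + complex.Re (g t)).
    by apply/funext => x; case: (f x) (g x) => [? ?] [].
  by apply: is_derive_eq; case: (f1 t) (g1 t) => [? ?] [].
have -> : (fun t => complex.Im (f t + g t)) = (fun t => complex.Im (f t) + complex.Im (g t)).
  by apply/funext => x; case: (f x) (g x) => [? ?] [].
by apply: is_derive_eq; case: (f1 t) (g1 t) => [? ?] [].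
Qed.

Lemma is_cderiveM f g f1 g1 : is_cderive f f1 -> is_cderive g g1 ->
  is_cderive (fun t => f t * g t) (fun t => f1 t * g t + f t * g1 t).
Proof.
move=> hf hg t; have [fr fi] := hf t; have [gr gi] := hg t; split.
  have -> : (fun t => complex.Re (f t * g t)) = (fun t =>
    complex.Re (f t) * complex.Re (g t) - complex.Im (f t) * complex.Im (g t)).
    by apply/funext => x; case: (f x) (g x) => [? ?] [].
  apply: is_derive_eq; rewrite /GRing.scale/=.
  by case: (f t) (g t) (f1 t) (g1 t) => [? ?] [? ?] [? ?] [? ?]/=; ring.
have -> : (fun t => complex.Im (f t * g t)) = (fun t =>
  complex.Re (f t) * complex.Im (g t) + complex.Im (f t) * complex.Re (g t)).
  by apply/funext => x; case: (f x) (g x) => [? ?] [].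
apply: is_derive_eq; rewrite /GRing.scale/=.
by case: (f t) (g t) (f1 t) (g1 t) => [? ?] [? ?] [? ?] [? ?]/=; ring.
Qed.

Lemma is_cderive_real (f g : R -> R) : (forall t, is_derive t (1 : R) f (g t)) ->
  is_cderive (fun t => (f t)%:C) (fun t => (g t)%:C).
Proof. by move=> df t; split=> //=; exact: is_derive_cst. Qed.

Lemma is_cderive_cis a : is_cderive (fun t => cis (a * t)) (fun t => 'i * a%:C * cis (a * t)).
Proof.
by move=> t; split=> /=; apply: is_derive_eq; rewrite /GRing.scale/=; ring.
Qed.

Section EdgeLift.
Variables (k a : R) (z0 z1 : C).

(* For [k = 0] and [k = pi] the division by [sin k = 0] gives 0, which selects
   the multiple of the cosine. *)
Definition lift_coef : C := (cis (- a) * z1 - z0 * (cos k)%:C) / (sin k)%:C.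

Definition edge_lift t : C :=
  cis (a * t) * (z0 * (cos (k * t))%:C + lift_coef * (sin (k * t))%:C).

Definition edge_lift' t : C := 'i * a%:C * edge_lift t +
  cis (a * t) * (k%:C * (- z0 * (sin (k * t))%:C + lift_coef * (cos (k * t))%:C)).

(** The second derivative as dictated by the eigenvalue equation: [edge_lift_eq] becomes algebra,
    and [dlift'] checks that it is the derivative of [edge_lift']. *)
Definition edge_lift'' t : C :=
  2 * 'i * a%:C * edge_lift' t + (a ^+ 2 - k ^+ 2)%:C * edge_lift t.

Let dcos : is_cderive (fun t => (cos (k * t))%:C) (fun t => (- k * sin (k * t))%:C).
Proof.
apply: is_cderive_real => t.
by apply: is_derive_eq; rewrite /GRing.scale/=; ring.
Qed.

Let dsin : is_cderive (fun t => (sin (k * t))%:C) (fun t => (k * cos (k * t))%:C).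
Proof.
apply: is_cderive_real => t.
by apply: is_derive_eq; rewrite /GRing.scale/=; ring.
Qed.

Let i2 : 'i * 'i = -1 :> C.
Proof. by apply/eqP; rewrite eq_complex/= !mul0r !mulr0 !mulr1 addr0 sub0r oppr0 !eqxx. Qed.

Let dlift : is_cderive edge_lift edge_lift'.
Proof.
have d1 := is_cderiveM (is_cderive_cst z0) dcos.
have d2 := is_cderiveM (is_cderive_cst lift_coef) dsin.
apply: (is_cderive_ext (is_cderiveM (is_cderive_cis a) (is_cderiveD d1 d2))) => t.
rewrite /edge_lift' /edge_lift !rmorphM rmorphN /=; ring.
Qed.

Let dlift' : is_cderive edge_lift' edge_lift''.
Proof.
have d1 := is_cderiveM (is_cderive_cst (- z0)) dsin.
have d2 := is_cderiveM (is_cderive_cst lift_coef) dcos.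
have d3 := is_cderiveM (is_cderive_cst k%:C) (is_cderiveD d1 d2).
have d4 := is_cderiveM (is_cderive_cis a) d3.
have d5 := is_cderiveM (is_cderive_cst ('i * a%:C)) dlift.
apply: (is_cderive_ext (is_cderiveD d5 d4)) => t.
rewrite /edge_lift'' {1 2}/edge_lift' /edge_lift !(rmorphM, rmorphB, rmorphN, rmorphXn) /=.
set A := a%:C; set K := k%:C.
have -> : A * A - K * K = - ('i * 'i) * (A * A) - K * K by rewrite i2 opprK mul1r.
ring.
Qed.

Lemma edge_lift_ac : ac_derivative edge_lift edge_lift' /\ ac_derivative edge_lift' edge_lift''.
Proof.
split; apply: is_cderive_ac => //; first exact: is_cderive_ccontinuous dlift'.
have d := is_cderiveD (is_cderiveM (is_cderive_cst (2 * 'i * a%:C)) dlift')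
  (is_cderiveM (is_cderive_cst (a ^+ 2 - k ^+ 2)%:C) dlift).
exact: is_cderive_ccontinuous d.
Qed.

Lemma edge_lift_continuous : ccontinuous edge_lift.
Proof. exact: is_cderive_ccontinuous dlift. Qed.

Lemma edge_lift_L2 : L2_01 edge_lift.
Proof. exact/ccontinuous_L2/edge_lift_continuous. Qed.

Lemma edge_lift''_L2 : L2_01 edge_lift''.
Proof.
have d := is_cderiveD (is_cderiveM (is_cderive_cst (2 * 'i * a%:C)) dlift')
  (is_cderiveM (is_cderive_cst (a ^+ 2 - k ^+ 2)%:C) dlift).
exact: ccontinuous_L2 (is_cderive_ccontinuous d).
Qed.

Lemma edge_lift_eq t :
  'i * ('i * edge_lift'' t + a%:C * edge_lift' t) +
    a%:C * ('i * edge_lift' t + a%:C * edge_lift t) =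
  (k ^+ 2)%:C * edge_lift t.
Proof.
rewrite mulrDr mulrA i2 /edge_lift'' rmorphB !rmorphXn /=.
set i : C := 'i; set A := a%:C; set K := k%:C; ring.
Qed.

Lemma edge_lift0 : edge_lift 0 = z0.
Proof. by rewrite /edge_lift !mulr0 cos0 sin0 cis0 mul1r mulr0 addr0 mulr1. Qed.

(** For [sin k = 0] the lift is [z0 * cis (a * t) * cos (k * t)], so its value at the far end is
    forced and z1 has to agree with it. *)
Lemma edge_lift1 : (sin k = 0 -> z1 = cis a * (cos k)%:C * z0) -> edge_lift 1 = z1.
Proof.
rewrite /edge_lift !mulr1 /lift_coef => h.
have [s0|sN] := eqVneq (sin k) 0.
  by rewrite s0 mulr0 addr0 h// -mulrA [z0 * _]mulrC.
rewrite mulfVK; last by rewrite (inj_eq (@complexI R)).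
by rewrite addrC subrK mulrA cisMN mul1r.
Qed.

(** Here and at the other end the factor [k / sin k] does not depend on the edge, so that it comes
    out of Kirchhoff's sum. For [sin k = 0] it is 0 by the convention on division, and so is the
    left-hand side. *)
Lemma edge_lift'0 : edge_lift' 0 - 'i * a%:C * edge_lift 0 =
  (k / sin k)%:C * (cis (- a) * z1 - (cos k)%:C * z0).
Proof.
rewrite /edge_lift' addrC addKr !mulr0 cos0 sin0 cis0 mul1r mulr0 add0r mulr1 /lift_coef.
by rewrite fmorph_div/= mulrCA mulrC [z0 * _]mulrC; ring.
Qed.

Lemma edge_lift'1 : edge_lift' 1 - 'i * a%:C * edge_lift 1 =
  (k / sin k)%:C * ((cos k)%:C * z1 - cis a * z0).
Proof.
rewrite /edge_lift' addrC addKr !mulr1 /lift_coef.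
have [s0|sN] := eqVneq (sin k) 0.
  by rewrite s0 (rmorph0 (@real_complex R)) !invr0 !mulr0 mul0r add0r !mulr0 mul0r.
have sN' : (sin k)%:C != 0 by rewrite (inj_eq (@complexI R)).
have CS : (cos k)%:C ^+ 2 = 1 - (sin k)%:C ^+ 2.
  by rewrite -!rmorphXn -(rmorph1 (@real_complex R)) -rmorphB/= -(cos2Dsin2 k) addrK.
have W := cisMN a.
rewrite fmorph_div/=.
transitivity ((k%:C / (sin k)%:C) * (- (cis a * z0 * (sin k)%:C ^+ 2) +
  (cis a * cis (- a)) * z1 * (cos k)%:C - cis a * z0 * (cos k)%:C ^+ 2)).
  by field.
rewrite W CS; ring.
Qed.

End EdgeLift.

End ExplicitSolutions.

(** * Eigenfunctions and vertex values *)

Section DiscreteForms.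
Variables (C : numClosedFieldType) (T E : eqType).
Variables (es : seq E) (en : E -> bool -> T) (ph : E -> C).
Hypothesis ph1 : forall e, ph e * (ph e)^* = 1.
Variables (N : nat) (vv : 'I_N -> T).

(** The transport factor along e towards its end b; the opposite direction has the conjugate
    factor. *)
Definition phase e (b : bool) : C := if b then ph e else (ph e)^*.

(** Extension by zero outside the listed vertices builds in the Dirichlet conditions. *)
Definition ext (x : 'rV[C]_N) (v : T) : C := \sum_i x 0 i * (vv i == v)%:R.

Definition adj_mx : 'M[C]_N := \matrix_(i, j) \sum_(e <- es) \sum_b
  phase e b * (vv i == en e (~~ b))%:R * (vv j == en e b)%:R.

(** An edge that leads to an unlisted vertex is still counted at its listed end, so Dirichlet
    conditions elsewhere do not lower the degree. A loop counts twice. *)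
Definition deg_row : 'rV[C]_N := \row_j \sum_(e <- es) \sum_b (vv j == en e b)%:R.

Lemma adj_mx_herm : adj_mx ^t* = adj_mx.
Proof.
apply/matrixP => i j; rewrite !mxE rmorph_sum/=; apply: eq_bigr => e _.
rewrite !big_bool /phase /= !rmorphD !rmorphM /= !conjC_nat conjCK addrC.
by congr (_ + _); rewrite mulrAC.
Qed.

Lemma ext_linear k (r : 'I_k -> C) (x : 'I_k -> 'rV[C]_N) v :
  ext (\sum_j r j *: x j) v = \sum_j r j * ext (x j) v.
Proof.
rewrite /ext; under eq_bigr do rewrite summxE mulr_suml.
rewrite exchange_big/=; apply: eq_bigr => j _.
by rewrite mulr_sumr; apply: eq_bigr => i _; rewrite mxE mulrA.
Qed.

Lemma ext0 v : ext 0 v = 0.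
Proof. by rewrite /ext big1// => i _; rewrite mxE mul0r. Qed.

Lemma mul_adj_mx x j : (x *m adj_mx) 0 j = \sum_(e <- es) \sum_b
  (en e b == vv j)%:R * (phase e b * ext x (en e (~~ b))).
Proof.
rewrite mxE; under eq_bigr do rewrite mxE mulr_sumr.
rewrite exchange_big/=; apply: eq_bigr => e _.
under eq_bigr do rewrite mulr_sumr.
rewrite exchange_big/=; apply: eq_bigr => b _.
rewrite /ext !mulr_sumr; apply: eq_bigr => i _.
by rewrite (eq_sym (vv j)); ring.
Qed.

Lemma mul_deg_row (x : 'rV[C]_N) j : (x *m diag_mx deg_row) 0 j =
  x 0 j * \sum_(e <- es) \sum_b (en e b == vv j)%:R.
Proof.
rewrite mul_mx_diag !mxE; congr (_ * _); apply: eq_bigr => e _.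
by apply: eq_bigr => b _; rewrite eq_sym.
Qed.

Lemma sum_conj_ext (y : 'rV[C]_N) (g : E -> bool -> C) :
  \sum_j (\sum_(e <- es) \sum_b (en e b == vv j)%:R * g e b) * (y 0 j)^* =
  \sum_(e <- es) \sum_b g e b * (ext y (en e b))^*.
Proof.
under eq_bigr do rewrite mulr_suml.
rewrite exchange_big/=; apply: eq_bigr => e _.
under eq_bigr do rewrite mulr_suml.
rewrite exchange_big/=; apply: eq_bigr => b _.
rewrite /ext rmorph_sum mulr_sumr; apply: eq_bigr => j _.
by rewrite rmorphM /= conjC_nat eq_sym; ring.
Qed.

Lemma adj_formE x y : (x *m adj_mx *m y ^t*) 0 0 = \sum_(e <- es) \sum_b
  phase e b * ext x (en e (~~ b)) * (ext y (en e b))^*.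
Proof.
rewrite mxE -sum_conj_ext; apply: eq_bigr => j _.
by rewrite mul_adj_mx !mxE.
Qed.

Hypothesis vv_inj : injective vv.

Lemma ext_vv x i : ext x (vv i) = x 0 i.
Proof.
rewrite /ext (bigD1 i)//= eqxx mulr1 big1 ?addr0// => j ne.
by rewrite (inj_eq vv_inj) (negPf ne) mulr0.
Qed.

Lemma ext_out x v : (forall i, vv i <> v) -> ext x v = 0.
Proof.
by move=> h; rewrite /ext big1// => i _; case: eqP => [/h//|_]; rewrite mulr0.
Qed.

Lemma deg_formE x y : (x *m diag_mx deg_row *m y ^t*) 0 0 = \sum_(e <- es) \sum_b
  ext x (en e b) * (ext y (en e b))^*.
Proof.
rewrite mxE -sum_conj_ext; apply: eq_bigr => j _.
rewrite mul_deg_row !mxE; congr (_ * _); rewrite mulr_sumr; apply: eq_bigr => e _.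
rewrite mulr_sumr; apply: eq_bigr => b _; rewrite mulrC.
by case: eqP => [->|_]; rewrite ?ext_vv ?mul0r.
Qed.

(* The edge (u,v) contributes [|x v - z ph x u|^2], as [|z| = |ph| = 1]. *)
Lemma deg_sub_adj x (z : C) : z \is Num.real -> z ^+ 2 = 1 ->
  qform (diag_mx deg_row) x - z * qform adj_mx x =
  \sum_(e <- es) `|ext x (en e true) - z * ph e * ext x (en e false)| ^+ 2.
Proof.
move=> /CrealP zr z2; rewrite /qform adj_formE deg_formE mulr_sumr -sumrB.
apply: eq_bigr => e _; rewrite !big_bool /phase /=.
rewrite normCK rmorphB !rmorphM /= zr; set P := ph e; set Pc := P^*.
have -> : forall u v uc vc : C, (u - z * P * v) * (uc - z * Pc * vc) =
  u * uc - z * P * v * uc - z * Pc * u * vc + z ^+ 2 * (P * Pc) * (v * vc).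
  by move=> *; ring.
by rewrite ph1 z2 !mul1r; ring.
Qed.

Lemma adj_le_deg x (z : C) : z \is Num.real -> z ^+ 2 = 1 ->
  z * qform adj_mx x <= qform (diag_mx deg_row) x.
Proof.
by move=> zr z2; rewrite -subr_ge0 deg_sub_adj// sumr_ge0// => e _; rewrite exprn_ge0.
Qed.

(** For the eigenvalue [z = 1] or [z = -1] the sum of squares in [deg_sub_adj] is 0, hence each
    square is. This provides the compatibility condition of [edge_lift1]. *)
Lemma pencil_extremal (x : 'rV[C]_N) (z : C) : z \is Num.real -> z ^+ 2 = 1 ->
  x *m adj_mx = z *: (x *m diag_mx deg_row) ->
  forall e, e \in es -> ext x (en e true) = z * ph e * ext x (en e false).
Proof.
move=> zr z2 xA e ees; apply/eqP; rewrite -subr_eq0 -normr_eq0 -sqrf_eq0.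
have : qform (diag_mx deg_row) x - z * qform adj_mx x = 0.
  by rewrite /qform xA -scalemxAl [X in _ * X]mxE mulrA -expr2 z2 mul1r subrr.
rewrite deg_sub_adj// => /eqP; rewrite psumr_eq0; last by move=> *; rewrite exprn_ge0.
by move=> /allP/(_ e ees).
Qed.

Hypothesis has_end : forall i, exists2 e, e \in es & exists b, en e b = vv i.

Lemma deg_row_gt0 i : 0 < deg_row 0 i.
Proof.
rewrite mxE lt0r; apply/andP; split; last first.
  by apply: sumr_ge0 => e _; apply: sumr_ge0 => b _; exact: ler0n.
rewrite psumr_neq0; last by move=> e _; apply: sumr_ge0 => b _; exact: ler0n.
have [e ees [b eb]] := has_end i; apply/hasP; exists e => //=.
rewrite lt0r; apply/andP; split; last by apply: sumr_ge0 => b' _; exact: ler0n.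
rewrite psumr_neq0; last by move=> b' _; exact: ler0n.
by apply/hasP; exists b; rewrite ?mem_index_enum//= -eb eqxx ltr01.
Qed.

Lemma deg_form_gt0 (x : 'rV[C]_N) : x != 0 -> 0 < qform (diag_mx deg_row) x.
Proof.
move=> /rV0Pn[i xi]; rewrite qform_diag lt0r; apply/andP; split; last first.
  by apply: sumr_ge0 => j _; rewrite mulr_ge0 ?exprn_ge0// ltW// deg_row_gt0.
rewrite psumr_neq0; last by move=> j _; rewrite mulr_ge0 ?exprn_ge0// ltW// deg_row_gt0.
apply/hasP; exists i; rewrite ?mem_index_enum//=.
by rewrite mulr_gt0 ?deg_row_gt0// exprn_gt0// normr_gt0.
Qed.

(** Both bounds are [adj_le_deg], for z = 1 and z = -1, divided by the positive degree form. *)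
Lemma pencil_bounds (x : 'rV[C]_N) (l : C) : l \is Num.real -> x != 0 ->
  x *m adj_mx = l *: (x *m diag_mx deg_row) -> -1 <= l <= 1.
Proof.
move=> lr x0 xA; have d0 := deg_form_gt0 x0.
have qE : qform adj_mx x = l * qform (diag_mx deg_row) x.
  by rewrite /qform xA -scalemxAl [LHS]mxE.
have h1 := @adj_le_deg x 1 (real1 _) (expr1n _ _).
have h2 : -1 * qform adj_mx x <= qform (diag_mx deg_row) x.
  by apply: adj_le_deg; rewrite ?rpredN ?real1// sqrrN expr1n.
rewrite qE mul1r ger_pMl// in h1; rewrite h1 andbT.
by move: h2; rewrite qE mulrA ger_pMl// mulN1r lerNl.
Qed.

(** The case of cos pi = -1: the form [A + D] is nonnegative everywhere. *)
Lemma form_ge_Nid (k : nat) : (k <= N)%N -> form_ge adj_mx (diag_mx deg_row) (-1) k.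
Proof.
move=> kN; exists 1%:M; rewrite mxrank1; split=> // x _.
rewrite mulN1r lerNl -mulN1r.
by apply: adj_le_deg; rewrite ?rpredN ?real1// sqrrN expr1n.
Qed.

End DiscreteForms.

Lemma eq_mx_form (C : numClosedFieldType) N (A B : 'M[C]_N) :
  (forall x y : 'rV[C]_N, (x *m A *m y ^t*) 0 0 = (x *m B *m y ^t*) 0 0) -> A = B.
Proof.
move=> h; apply/matrixP => i j.
have e (M : 'M[C]_N) :
    M i j = ((delta_mx 0 i : 'rV[C]_N) *m M *m (delta_mx 0 j : 'rV[C]_N) ^t*) 0 0.
  by rewrite trmx_delta map_delta_mx -rowE -colE !mxE.
by rewrite [LHS]e h -e.
Qed.

(** * Eigenfunctions of a graph operator versus eigenvectors of its pencil *)

Section MagneticGraph.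
Variables (R : realType) (T E : choiceType).
Local Notation C := R[i].
Local Notation mu := (@lebesgue_measure R).
Local Open Scope complex_scope.
Implicit Types (G : mgraph T E) (a : E -> R) (D : set T) (y f : gfun R E).

(** A common generalization, so that one spectral analysis serves all operators: the Floquet
    operators have D empty, the Neumann and Dirichlet operators have a = 0. *)
Definition dirichlet_magnetic_laplacian G a D : goper R E := fun y f =>
  [/\ L2 G y, L2 G f &
   exists w p q,
     [/\ ae_eq_on G y w, H2 G w p q, continuous_at_vertices G w,
         (forall v, D v -> vanishes_at G v w) /\
         (forall v, mg_vert G v -> ~ D v ->
            kirchhoff_at G v (fun e t => p e t - 'i * (a e)%:C * w e t)) &
         ae_eq_on G f (magnetic a (magnetic a w p) (magnetic a p q))]].

Lemma magnetic_laplacianE G a :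
  magnetic_laplacian G a = dirichlet_magnetic_laplacian G a set0.
Proof.
apply/funext => y; apply/funext => f; apply/propext; split.
  move=> [Ly Lf [w [p [q [yw H cw kw fw]]]]]; split=> //; exists w, p, q; split=> //.
  by split=> // v vG _; exact: kw.
move=> [Ly Lf [w [p [q [yw H cw [_ kw] fw]]]]]; split=> //; exists w, p, q; split=> //.
by move=> v vG; exact: kw.
Qed.

Lemma metric_laplacianE G D :
  metric_laplacian G D = dirichlet_magnetic_laplacian G (fun=> 0 : R) D.
Proof.
have kE (w p : gfun R E) : (fun e t => p e t - 'i * (0 : R)%:C * w e t) = p.
  by apply/funext => e; apply/funext => t; rewrite mulr0 mul0r subr0.
have mE w p q : magnetic (fun=> 0) (magnetic (fun=> 0) w p) (magnetic (fun=> 0) p q) =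
    (fun (e : E) (t : R) => - q e t) :> gfun R E.
  apply/funext => e; apply/funext => t; rewrite /magnetic !mul0r !addr0.
  by rewrite mulrA -expr2 sqr_i mulN1r.
apply/funext => y; apply/funext => f; apply/propext; split;
  move=> [Ly Lf [w [p [q [yw H cw kw fw]]]]]; split=> //; exists w, p, q;
  by split=> //; move: kw fw; rewrite ?kE ?mE.
Qed.

Lemma sum_ends_at G v (f : E * bool -> C) : finite_set (mg_edge G) ->
  \sum_(x \in ends_at G v) f x =
  \sum_(e <- fset_set (mg_edge G)) \sum_b (mg_end G e b == v)%:R * f (e, b).
Proof.
move=> fE.
pose s : seq E := fset_set (mg_edge G).
have mems e : (e \in s) = (e \in mg_edge G) by rewrite in_fset_set.
pose half b : seq (E * bool) := [seq (e, b) | e <- s].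
have memh x b : (x \in half b) = (x.1 \in mg_edge G) && (x.2 == b).
  apply/mapP/andP => [[e es ->]|[xs /eqP <-]]; first by rewrite -mems eqxx.
  by exists x.1; rewrite ?mems//; case: (x).
pose r := [seq x <- half true ++ half false | mg_end G x.1 x.2 == v].
have memr x : (x \in r) = (x \in ends_at G v).
  rewrite mem_filter mem_cat !memh -andb_orr (_ : _ || _ = true) ?andbT; last by case: x.2.
  apply/andP/idP; first by rewrite !inE => -[/eqP ? ?].
  by rewrite !inE => -[? /eqP ?].
have fv : finite_set (ends_at G v).
  apply/finite_seqP; exists r; apply/seteqP; split=> x /=.
    by move=> xv; rewrite memr inE.
  by rewrite memr inE.
have uh b : uniq (half b) by rewrite map_inj_uniq ?fset_uniq// => e e' [].
rewrite fsbig_finite//= (perm_big r); last first.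
  apply: uniq_perm; first exact: fset_uniq.
    rewrite filter_uniq// cat_uniq !uh andbT/=; apply/hasPn => x.
    by rewrite !memh => /andP[_ /eqP ->]; rewrite andbF.
  by move=> x; rewrite memr in_fset_set.
rewrite big_filter big_mkcond/= big_cat/= !big_map -big_split/=; apply: eq_bigr => e _.
by rewrite big_bool; congr (_ + _); rewrite /=; case: eqP; rewrite ?mul1r ?mul0r.
Qed.

Section Spectrum.
Variables (G : mgraph T E) (a : E -> R) (D : set T).
Hypothesis finE : finite_set (mg_edge G).
Hypothesis endsV : forall e b, mg_edge G e -> mg_vert G (mg_end G e b).
Variables (N : nat) (vv : 'I_N -> T).
Hypothesis vv_inj : injective vv.
Hypothesis vvP : forall v, (mg_vert G v /\ ~ D v) <-> exists i, vv i = v.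
Hypothesis has_end : forall i, exists e b, mg_edge G e /\ mg_end G e b = vv i.

Local Notation es := (fset_set (mg_edge G) : seq E).
Local Notation ph := (fun e => cis (a e)).
Local Notation A := (adj_mx es (mg_end G) ph vv).
Local Notation Dg := (diag_mx (deg_row C es (mg_end G) vv)).
Local Notation lap := (dirichlet_magnetic_laplacian G a D).
Local Notation ext := (ext vv).

Lemma mem_edges e : (e \in es) = (e \in mg_edge G).
Proof. by rewrite in_fset_set. Qed.

Lemma has_end_seq i : exists2 e, e \in es & exists b, mg_end G e b = vv i.
Proof.
have [e [b [eG eb]]] := has_end i; exists e; last by exists b.
by rewrite mem_edges inE.
Qed.

Lemma unit_phase e : ph e * (ph e)^*%R = 1.
Proof. by rewrite -[X in _ * X]/(conjc _) cis_conj cisMN. Qed.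

Lemma phaseE e b : phase ph e b = cis (if b then a e else - a e).
Proof. by case: b; rewrite //= -[LHS]/(conjc _) cis_conj. Qed.

Lemma row_eq0_ext (x : 'rV[C]_N) :
  (forall e b, mg_edge G e -> ext x (mg_end G e b) = 0) -> x = 0.
Proof.
move=> h; apply/rowP => i; rewrite [RHS]mxE -(ext_vv vv_inj).
by have [e [b [eG <-]]] := has_end i; exact: h.
Qed.

Lemma pencil_eqP (x : 'rV[C]_N) (l : C) :
  x *m A = l *: (x *m Dg) <->
  forall i, \sum_(e <- es) \sum_b (mg_end G e b == vv i)%:R *
    (l * ext x (mg_end G e b) - phase ph e b * ext x (mg_end G e (~~ b))) = 0.
Proof.
have sumE i : \sum_(e <- es) \sum_b (mg_end G e b == vv i)%:R *
    (l * ext x (mg_end G e b) - phase ph e b * ext x (mg_end G e (~~ b))) =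
  (l *: (x *m Dg)) 0 i - (x *m A) 0 i.
  rewrite mul_adj_mx [in RHS]mxE mul_deg_row !mulr_sumr -sumrB; apply: eq_bigr => e _.
  rewrite !mulr_sumr -sumrB; apply: eq_bigr => b _; rewrite mulrBr; congr (_ - _).
  case: eqP => [->|_]; last by rewrite mul0r !mulr0.
  by rewrite ext_vv// mul1r !mulr1.
split=> [xA i|h]; first by rewrite sumE xA subrr.
by apply/rowP => i; have /eqP := h i; rewrite sumE subr_eq0 => /eqP.
Qed.

(** The common factor z is [1 / s 1] when an eigenfunction is given and [k / sin k] when one is
    built; in the second case it may be 0. *)
Lemma kirchhoff_pencil (x : 'rV[C]_N) (l z : C) (r : gfun R E) :
  (forall e b, mg_edge G e -> delta R b * r e b%:R =
    z * (l * ext x (mg_end G e b) - phase ph e b * ext x (mg_end G e (~~ b)))) ->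
  forall i, kirchhoff_at G (vv i) r <->
    z * \sum_(e <- es) \sum_b (mg_end G e b == vv i)%:R *
      (l * ext x (mg_end G e b) - phase ph e b * ext x (mg_end G e (~~ b))) = 0.
Proof.
move=> h i; rewrite /kirchhoff_at sum_ends_at//= mulr_sumr.
suff -> : \sum_(e <- es) \sum_b (mg_end G e b == vv i)%:R * (delta R b * r e b%:R) =
  \sum_(e <- es) z * \sum_b (mg_end G e b == vv i)%:R *
      (l * ext x (mg_end G e b) - phase ph e b * ext x (mg_end G e (~~ b))) by [].
apply: eq_big_seq => e; rewrite mem_edges inE => eG.
by rewrite mulr_sumr; apply: eq_bigr => b _; rewrite h// mulrCA.
Qed.

(** The vector x is chosen before the pair (c, s), so the same vertex values can be used with any
    fundamental pair for m. *)
Lemma eigenvector_boundary m y : eigenvector lap m y ->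
  exists x : 'rV[C]_N, forall c s, fundamental_pair m c s -> s 1 != 0 ->
    x *m A = (c 1)%:C *: (x *m Dg) /\
    forall e, mg_edge G e -> {ae mu, forall t, t \in `[0, 1] -> y e t =
      cis (a e * t) * (ext x (mg_end G e false) * (c t)%:C +
        (cis (- a e) * ext x (mg_end G e true) - (c 1)%:C * ext x (mg_end G e false))
          / (s 1)%:C * (s t)%:C)}.
Proof.
move=> [_ _ [w [p [q [yw [H _] cw [dw kw] fw]]]]].
have /choice[eb ebP] : forall i, exists eb : E * bool,
    mg_edge G eb.1 /\ mg_end G eb.1 eb.2 = vv i.
  by move=> i; have [e [b eP]] := has_end i; exists (e, b).
(* The value at a free vertex is taken at an arbitrary edge end there; continuity makes the choice
   irrelevant. *)
pose x : 'rV[C]_N := \row_i w (eb i).1 (eb i).2%:R.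
have wE e (b : bool) : mg_edge G e -> w e b%:R = ext x (mg_end G e b).
  move=> eG; have [De|nDe] := pselect (D (mg_end G e b)).
    rewrite (dw _ De)// ext_out// => i iE.
    by have [_] := (vvP (vv i)).2 (ex_intro _ i erefl); rewrite iE.
  have [i iE] := (vvP _).1 (conj (endsV b eG) nDe).
  have [ebG ebE] := ebP i.
  by rewrite -iE ext_vv// mxE; apply: cw => //; rewrite ebE.
exists x => c s fcs s1.
have s1C : (s 1)%:C != 0 :> C by rewrite (inj_eq (@complexI R)).
have sol e : mg_edge G e -> forall t, t \in `[0, 1] ->
    w e t = cis (a e * t) * (w e 0 * (c t)%:C + (p e 0 - 'i * (a e)%:C * w e 0) * (s t)%:C) /\
    p e t - 'i * (a e)%:C * w e t = cis (a e * t) *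
      (- (m%:C * w e 0) * (s t)%:C + (p e 0 - 'i * (a e)%:C * w e 0) * (c t)%:C).
  move=> eG; have [wp pq] := H e eG; apply: edge_solution fcs wp pq _.
  apply: (@filterS2 _ _ (ae_filter_ringOfSetsType mu) _ _ _ _ (yw e eG) (fw e eG)).
  by move=> t yt ft t01; have := ft t01; rewrite yt// => /esym.
have i0 : (0 : R) \in `[0, 1] by rewrite in_itv/= lexx ler01.
have i1 : (1 : R) \in `[0, 1] by rewrite in_itv/= lexx ler01.
have W := fundamental_pair_wronskian fcs 1.
have W' : (c 1)%:C ^+ 2 + m%:C * (s 1)%:C ^+ 2 = 1 :> C.
  by rewrite -!rmorphXn -rmorphM -rmorphD W.
(* The value of w at 1 is solved for the initial slope, which is possible since [s 1 != 0]. *)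
have r0E e : mg_edge G e -> p e 0 - 'i * (a e)%:C * w e 0 =
    (cis (- a e) * ext x (mg_end G e true) - (c 1)%:C * ext x (mg_end G e false)) / (s 1)%:C.
  move=> eG; have [w1 _] := sol e eG 1 i1.
  rewrite -(wE e true eG) -(wE e false eG) /= w1 mulr1 mulrA [cis _ * cis _]mulrC cisMN mul1r.
  by field.
split.
  apply/pencil_eqP => i.
  have [vG nD] := (vvP (vv i)).2 (ex_intro _ i erefl).
  have := kw _ vG nD.
  rewrite (@kirchhoff_pencil x (c 1)%:C (s 1)%:C^-1).
    by move=> /eqP; rewrite mulf_eq0 invr_eq0 (negPf s1C) => /eqP.
  move=> e b eG; rewrite phaseE; case: b => /=.
    have [_ ->] := sol e eG 1 i1; rewrite r0E// mulr1 mul1r.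
    have -> : w e 0 = ext x (mg_end G e false) := wE e false eG.
    set u := ext x (mg_end G e false); set v := ext x (mg_end G e true).
    (* The terms are grouped so that [cisMN] and then the Wronskian identity apply. *)
    transitivity ((s 1)%:C^-1 * (- (cis (a e) * u * (m%:C * (s 1)%:C ^+ 2)) +
      cis (a e) * cis (- a e) * v * (c 1)%:C - cis (a e) * u * (c 1)%:C ^+ 2)).
      by field.
    rewrite cisMN; transitivity ((s 1)%:C^-1 * (v * (c 1)%:C -
      cis (a e) * u * ((c 1)%:C ^+ 2 + m%:C * (s 1)%:C ^+ 2))); first by ring.
    by rewrite W'; ring.
  by rewrite r0E// mulN1r; field.
move=> e eG; apply: (@filterS _ _ (ae_filter_ringOfSetsType mu) _ _ _ (yw e eG)) => t yt t01.
by rewrite yt//; have [-> _] := sol e eG t t01; rewrite r0E// -(wE e false eG).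
Qed.

Lemma lin_indep_neq0 n (y : 'I_n -> gfun R E) j : lin_indep G y ->
  ~ ae_eq_on G (y j) (fun _ _ => 0).
Proof.
move=> yli y0; have : (fun i : 'I_n => (i == j)%:R : C) j = 0.
  apply: (yli (fun i => (i == j)%:R)) => e eG.
  apply: (@filterS _ _ (ae_filter_ringOfSetsType mu) _ _ _ (y0 e eG)) => t yt t01.
  rewrite big1// => i _; have [->|_] := eqVneq i j; last by rewrite mul0r.
  by rewrite yt// mulr0.
by rewrite eqxx => /eqP; rewrite oner_eq0.
Qed.

Lemma realC_real (r : R) : r%:C \is Num.real.
Proof. by rewrite realE !lecR; exact: le_total. Qed.

Lemma cos_le (r s : R) : 0 <= r -> r <= s -> s <= pi -> cos s <= cos r.
Proof.
move=> r0; rewrite le_eqVlt => /predU1P[->//|rs] spi; apply/ltW.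
by rewrite ltr_cos// in_itv/= ?r0 ?spi ?(ltW (le_lt_trans r0 rs)) ?(ltW (lt_le_trans rs spi)).
Qed.

(** Independence of the functions has to pass to their vertex vectors. A relation between vectors
    splits by eigenvalue, and for one eigenvalue the functions depend linearly on the vectors with
    fixed coefficients, so the relation lifts to the functions. *)
Lemma eigen_to_pencil k n : 0 <= k < pi ->
  mult_ge G lap (fun m => m <= k ^+ 2) n -> pencil_ge A Dg (fun l => (cos k)%:C <= l) n.
Proof.
move=> /andP[k0 kpi] [m [y [yli my]]].
have /choice[X XP] := fun j => eigenvector_boundary (my j).2.
(* A negative eigenvalue would put [c 1 > 1] into the spectrum of the pencil; hence the vertex
   vector is 0, and with it the eigenfunction. *)
have m0 j : 0 <= m j.
  rewrite leNgt; apply/negP => mn.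
  have [c [s [fcs c1 s1]]] := fundamental_pair_hyperbolic mn.
  have [xA yE] := XP j c s fcs s1.
  have x0 : X j = 0.
    apply/eqP; apply: contraT => xN.
    have /andP[_] := pencil_bounds unit_phase vv_inj has_end_seq (realC_real _) xN xA.
    by rewrite -(rmorph1 (@real_complex R)) lecR leNgt c1.
  apply: (lin_indep_neq0 yli (j := j)) => e eG.
  apply: (@filterS _ _ (ae_filter_ringOfSetsType mu) _ _ _ (yE e eG)) => t yt t01.
  by rewrite yt// x0 !ext0 !(mulr0, mul0r, subr0, addr0).
pose k_ j := Num.sqrt (m j).
have mE j : m j = k_ j ^+ 2 by rewrite sqr_sqrtr.
have k_0 j : 0 <= k_ j by exact: sqrtr_ge0.
have k_k j : k_ j <= k by rewrite -(ler_sqr (k_0 j))// -mE; exact: (my j).1.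
have k_pi j : 0 <= k_ j < pi by rewrite k_0 (le_lt_trans (k_k j)).
have k_in j : k_ j \in `[0, pi].
  by rewrite in_itv/=; have /andP[-> /ltW ->] := k_pi j.
have /choice[cs csP] j : exists cs : (R -> R) * (R -> R),
    [/\ fundamental_pair (m j) cs.1 cs.2, cs.1 1 = cos (k_ j) & cs.2 1 != 0].
  by have [c [s cs]] := fundamental_pair_trig (k_pi j); exists (c, s); rewrite mE.
have XA j : X j *m A = (cos (k_ j))%:C *: (X j *m Dg).
  by have [fcs <- s1] := csP j; have [] := XP j _ _ fcs s1.
exists (fun j => (cos (k_ j))%:C), (\matrix_j X j); split; last first.
  move=> i; rewrite rowK; split=> //.
  by rewrite lecR cos_le// ltW.
apply: inj_row_free => r rX; apply/rowP => j0; rewrite [RHS]mxE.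
have S0 : \sum_j r 0 j *: X j = 0.
  by rewrite -[RHS]rX mulmx_sum_row; apply: eq_bigr => j _; rewrite rowK.
have sep := pencil_separate (adj_mx_herm es (mg_end G) ph vv) (deg_row_gt0 C has_end_seq)
  XA S0 (cos (k_ j0))%:C.
pose c j : C := if (cos (k_ j))%:C == (cos (k_ j0))%:C :> C then r 0 j else 0.
have {}sep : \sum_j c j *: X j = 0.
  rewrite -[RHS]sep [RHS]big_mkcond/=; apply: eq_bigr => j _; rewrite /c.
  by case: ifP => // _; rewrite scale0r.
have <- : c j0 = r 0 j0 by rewrite /c eqxx.
have [fcs c1 s1] := csP j0.
apply: (yli c) => e eG; set s := (cs j0).2 in s1.
(* K0 and K1 are the solutions on e with end values (1, 0) and (0, 1); they depend on the eigenvalue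
   but not on j. *)
pose K0 t : C := cis (a e * t) * (((cs j0).1 t)%:C - ((cs j0).1 1)%:C / (s 1)%:C * (s t)%:C).
pose K1 t : C := cis (a e * t) * (cis (- a e) / (s 1)%:C * (s t)%:C).
have h j : {ae mu, forall t, t \in `[0, 1] -> c j * y j e t =
    K0 t * (c j * ext (X j) (mg_end G e false)) + K1 t * (c j * ext (X j) (mg_end G e true))}.
  rewrite /c; case: ifPn => [/eqP/complexI/(cos_inj (k_in _) (k_in _)) kE|_]; last first.
    by apply: aeW => t _; rewrite !mul0r !mulr0 addr0.
  have fcsj : fundamental_pair (m j) (cs j0).1 s by rewrite mE kE -mE.
  have [_ yE] := XP j _ _ fcsj s1.
  apply: (@filterS _ _ (ae_filter_ringOfSetsType mu) _ _ _ (yE e eG)) => t yt t01.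
  by rewrite yt// /K0 /K1; ring.
have := @filter_forall _ _ _ _ (ae_filter_ringOfSetsType mu) h.
apply: (@filterS _ _ (ae_filter_ringOfSetsType mu)) => t yt t01.
under eq_bigr do rewrite yt//.
rewrite big_split/= -!mulr_sumr -!ext_linear.
by rewrite sep !ext0 !mulr0 addr0.
Qed.

(** The eigenvalues of the pencil lie in [-1, 1], so each is the cosine of some s in [0, pi], and
    [s <= k] as cos decreases. The lifts of the vectors are the eigenfunctions. *)
Lemma pencil_to_eigen k n : 0 <= k <= pi ->
  pencil_ge A Dg (fun l => l \is Num.real /\ (cos k)%:C <= l) n ->
  mult_ge G lap (fun m => exists2 s, 0 <= s <= k & m = s ^+ 2) n.
Proof.
move=> /andP[k0 kpi] [l [X [Xf lX]]].
have X0 j : row j X != 0.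
  apply/eqP => /eqP; rewrite rowE mulmx_free_eq0// => /eqP/rowP/(_ j)/eqP.
  by rewrite !mxE !eqxx oner_eq0.
have /choice[r rP] j : exists r : R, l j = r%:C /\ -1 <= r <= 1.
  have [[lr _] xA] := lX j.
  have := pencil_bounds unit_phase vv_inj has_end_seq lr (X0 j) xA.
  case: (l j) => u v; rewrite !lecE/= !oppr0 => /andP[/andP[/eqP -> h1] /andP[_ h2]].
  by exists u; rewrite h1 h2.
pose s j := acos (r j).
have cosE j : cos (s j) = r j by apply: acosK; rewrite in_itv/=; have [_] := rP j.
have s0 j : 0 <= s j <= pi.
  by have [_ rb] := rP j; rewrite acos_ge0// acos_lepi.
have sk j : s j <= k.
  rewrite leNgt; apply/negP => ks; have [[_ ck] _] := lX j.
  move: ck; rewrite (rP j).1 lecR leNgt -cosE => /negP; apply.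
  have /andP[sj0 sjpi] := s0 j.
  by rewrite ltr_cos// in_itv/= ?k0 ?sj0.
have XA j : row j X *m A = (cos (s j))%:C *: (row j X *m Dg).
  by rewrite cosE -(rP j).1; have [_] := lX j.
pose z j e b := ext (row j X) (mg_end G e b).
pose y j : gfun R E := fun e => edge_lift (s j) (a e) (z j e false) (z j e true).
pose y' j : gfun R E := fun e => edge_lift' (s j) (a e) (z j e false) (z j e true).
pose y'' j : gfun R E := fun e => edge_lift'' (s j) (a e) (z j e false) (z j e true).
have yb j e (b : bool) : mg_edge G e -> y j e b%:R = z j e b.
  move=> eG; case: b => /=; last by rewrite /y edge_lift0.
  (* When [sin (s j) = 0] the eigenvalue of the pencil is 1 or -1, and [pencil_extremal] supplies
     the forced end value. *)
  rewrite /y edge_lift1// => sin0; rewrite /z.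
  have := pencil_extremal unit_phase vv_inj (realC_real (cos (s j))) _ (XA j).
  move=> /(_ _ e) ->; rewrite ?mem_edges ?inE//.
    by rewrite [cis _ * _]mulrC.
  by have := cos2Dsin2 (s j); rewrite sin0 expr0n addr0 -rmorphXn/= => ->.
exists (fun j => s j ^+ 2), y; split.
  move=> c c0 j.
  (* A vanishing combination of lifts vanishes at all edge ends, where it is the combination of the
     vectors. *)
  have S0 : \sum_j c j *: row j X = 0.
    apply: row_eq0_ext => e b eG; rewrite ext_linear.
    have yc : ccontinuous (fun t => \sum_j c j * y j e t).
      by apply: ccontinuous_sum => i; apply: ccontinuousZ; exact: edge_lift_continuous.
    have [h0 h1] := ccontinuous_ae_eq0 yc (c0 e eG).
    under eq_bigr do rewrite -[ext _ _]/(z _ e b) -yb//.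
    by case: (b).
  have : (\row_i c i) *m X = 0.
    rewrite mulmx_sum_row -[RHS]S0; apply: eq_bigr => i _; by rewrite mxE.
  by move/eqP; rewrite mulmx_free_eq0// => /eqP/rowP/(_ j); rewrite !mxE.
move=> j; split; first by exists (s j) => //; rewrite sk andbT; have /andP[] := s0 j.
split.
- by move=> e _; exact: edge_lift_L2.
- by move=> e _; apply: ccontinuous_L2; apply: ccontinuousZ; exact: edge_lift_continuous.
exists (y j), (y' j), (y'' j); split.
- by move=> e _; exact: aeW.
- split; first by move=> e _; exact: edge_lift_ac.
  by move=> e _; exact: edge_lift''_L2.
- by move=> e e' b b' eG eG' ee; rewrite !yb// /z ee.
- split.
    move=> v Dv e b eG ev; rewrite yb// /z ext_out// => i iE.
    by have [_] := (vvP (vv i)).2 (ex_intro _ i erefl); rewrite iE ev.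
  move=> v vG nD; have [i <-] := (vvP v).1 (conj vG nD).
  apply/(@kirchhoff_pencil (row j X) (cos (s j))%:C (s j / sin (s j))%:C).
    move=> e b eG; rewrite phaseE; case: b => /=.
      by rewrite /y' /y edge_lift'1 mul1r.
    by rewrite /y' /y edge_lift'0 mulN1r -mulrN opprB.
  by rewrite (pencil_eqP _ _).1 ?mulr0.
- move=> e _; apply: aeW => t _; rewrite /magnetic.
  exact/esym/edge_lift_eq.
Qed.

End Spectrum.
End MagneticGraph.

(** * Restricted square roots *)

Section InnerProduct.
Variable R : realType.
Local Notation C := R[i].
Local Notation mu := (@lebesgue_measure R).
Local Open Scope complex_scope.
Implicit Types (f g h : R -> R).

Let m01 : measurable (`[0, 1]%classic : set (measurableTypeR R)).
Proof. exact: measurable_itv. Qed.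

Lemma real_L2_mul f g : real_L2 f -> real_L2 g ->
  mu.-integrable `[0, 1] (fun t => (f t * g t)%:E).
Proof.
move=> [mf f2] [mg g2].
apply: (le_integrable m01 _ _ (integrableD m01 f2 g2)).
  by apply/measurable_EFinP; exact: measurable_funM.
move=> t _; rewrite [X in (_ <= `|X|)%E](_ : _ = (f t ^+ 2 + g t ^+ 2)%:E)//.
rewrite lee_fin normrM [leRHS]ger0_norm ?addr_ge0 ?sqr_ge0//.
rewrite -(real_normK (num_real (f t))) -(real_normK (num_real (g t))).
by have := sqr_ge0 (`|f t| - `|g t|); have := normr_ge0 (f t); have := normr_ge0 (g t); nra.
Qed.

Lemma real_L2_comb (a b : R) f g : real_L2 f -> real_L2 g ->
  real_L2 (fun t => a * f t + b * g t).
Proof.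
move=> f2 g2; split.
  by apply: measurable_funD; apply: measurable_funM => //; [exact: f2.1|exact: g2.1].
have i1 := integrableZl m01 (a ^+ 2) f2.2.
have i2 := integrableZl m01 (2 * a * b) (real_L2_mul f2 g2).
have i3 := integrableZl m01 (b ^+ 2) g2.2.
apply: (eq_integrable m01 _ _ _ (integrableD m01 (integrableD m01 i1 i2) i3)) => t _ /=.
by rewrite -!EFinM -!EFinD; congr EFin; ring.
Qed.

Definition real_inner f g : R := \int[mu]_(t in `[0, 1]) (f t * g t).

Lemma real_innerC f g : real_inner f g = real_inner g f.
Proof. by apply: eq_Rintegral => t _; rewrite mulrC. Qed.

Lemma real_inner_comb (a b : R) f g h : real_L2 f -> real_L2 g -> real_L2 h ->
  real_inner (fun t => a * f t + b * g t) h = a * real_inner f h + b * real_inner g h.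
Proof.
move=> f2 g2 h2; have i1 := real_L2_mul f2 h2; have i2 := real_L2_mul g2 h2.
rewrite /real_inner -RintegralZl// -RintegralZl// -RintegralD//.
- by apply: eq_Rintegral => t _; ring.
- exact: (integrableZl m01 a i1).
- exact: (integrableZl m01 b i2).
Qed.

Lemma real_inner_ge0 f : 0 <= real_inner f f.
Proof. by apply: Rintegral_ge0 => t _; rewrite -expr2 sqr_ge0. Qed.

Lemma real_inner_eq0 f : real_L2 f -> real_inner f f = 0 ->
  {ae mu, forall t, t \in `[0, 1] -> f t = 0}.
Proof.
move=> f2 f0; have fi := real_L2_mul f2 f2.
have : (\int[mu]_(t in `[0%R, 1%R]) `|(f t * f t)%:E| = 0)%E.
  under eq_integral do rewrite gee0_abs ?lee_fin -?expr2 ?sqr_ge0//.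
  rewrite -(fineK (integrable_fin_num m01 f2.2)); congr EFin.
  by rewrite -[RHS]f0; congr fine; apply: eq_integral => t _; rewrite expr2.
have mff := measurable_int mu fi.
move=> /(ae_eq_integral_abs mu m01 mff).
apply: (@filterS _ _ (ae_filter_ringOfSetsType mu)) => t ft t01.
by have /= [/eqP] := ft t01; rewrite mulf_eq0 orbb => /eqP.
Qed.

Lemma real_inner_ae f g h : real_L2 f -> real_L2 g -> real_L2 h ->
  {ae mu, forall t, t \in `[0, 1] -> f t = g t} -> real_inner f h = real_inner g h.
Proof.
move=> f2 g2 h2 fg; congr fine; apply: ae_eq_integral => //.
- exact: measurable_int (real_L2_mul f2 h2).
- exact: measurable_int (real_L2_mul g2 h2).
- apply: (@filterS _ _ (ae_filter_ringOfSetsType mu) _ _ _ fg) => t ft t01.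
  by rewrite ft.
Qed.

Implicit Types (u v w : R -> C).
Local Notation re u := (fun t => complex.Re (u t)).
Local Notation im u := (fun t => complex.Im (u t)).

Definition edge_inner u v : C := cintegral `[0, 1] (fun t => u t * (v t)^*).

Lemma edge_innerE u v : L2_01 u -> L2_01 v -> edge_inner u v =
  (real_inner (re u) (re v) + real_inner (im u) (im v)) +i*
  (real_inner (im u) (re v) - real_inner (re u) (im v)).
Proof.
move=> [u1 u2] [v1 v2]; rewrite /edge_inner /cintegral /real_inner.
rewrite -RintegralD//; try exact: real_L2_mul.
rewrite -RintegralB//; try exact: real_L2_mul.
apply/eqP; rewrite eq_complex/=; apply/andP; split; apply/eqP; apply: eq_Rintegral => t _;
  by case: (u t) (v t) => [? ?] [? ?] /=; ring.
Qed.

Lemma L2_01_comb (a b : C) u v : L2_01 u -> L2_01 v -> L2_01 (fun t => a * u t + b * v t).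
Proof.
case: a b => [a1 a2] [b1 b2] [u1 u2] [v1 v2]; split.
  have := real_L2_comb 1 1 (real_L2_comb a1 (- a2) u1 u2) (real_L2_comb b1 (- b2) v1 v2).
  by congr real_L2; apply/funext => t; case: (u t) (v t) => [? ?] [? ?] /=; ring.
have := real_L2_comb 1 1 (real_L2_comb a1 a2 u2 u1) (real_L2_comb b1 b2 v2 v1).
by congr real_L2; apply/funext => t; case: (u t) (v t) => [? ?] [? ?] /=; ring.
Qed.

Lemma edge_inner_comb (a b : C) u v w : L2_01 u -> L2_01 v -> L2_01 w ->
  edge_inner (fun t => a * u t + b * v t) w = a * edge_inner u w + b * edge_inner v w.
Proof.
move=> u2 v2 w2; rewrite !edge_innerE//; last exact: L2_01_comb.
case: a b => [a1 a2] [b1 b2]; case: u2 v2 w2 => [u1 u2] [v1 v2] [w1 w2].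
(* Nested two-term combinations with outer coefficients 1 have the shape that [real_inner_comb]
   accepts. *)
have reE : re (fun t => (a1 +i* a2) * u t + (b1 +i* b2) * v t) =
    (fun t => 1 * (a1 * complex.Re (u t) + - a2 * complex.Im (u t)) +
      1 * (b1 * complex.Re (v t) + - b2 * complex.Im (v t))).
  by apply/funext => t; case: (u t) (v t) => [? ?] [? ?] /=; ring.
have imE : im (fun t => (a1 +i* a2) * u t + (b1 +i* b2) * v t) =
    (fun t => 1 * (a1 * complex.Im (u t) + a2 * complex.Re (u t)) +
      1 * (b1 * complex.Im (v t) + b2 * complex.Re (v t))).
  by apply/funext => t; case: (u t) (v t) => [? ?] [? ?] /=; ring.
rewrite reE imE.
rewrite !(@real_inner_comb 1 1); try (exact: real_L2_comb || done).
rewrite !real_inner_comb//.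
by apply/eqP; rewrite eq_complex/=; apply/andP; split; apply/eqP; ring.
Qed.

Lemma edge_inner_conj u v : L2_01 u -> L2_01 v -> edge_inner v u = (edge_inner u v)^*.
Proof.
move=> u2 v2; rewrite !edge_innerE//; apply/eqP; rewrite eq_complex/=.
rewrite (real_innerC (re v)) (real_innerC (im v)) [real_inner (im v) _]real_innerC.
by rewrite [real_inner (re v) _]real_innerC opprB !eqxx.
Qed.

Lemma edge_inner_ge0 u : L2_01 u -> 0 <= edge_inner u u.
Proof.
move=> u2; rewrite edge_innerE// lecE/= addr_ge0 ?real_inner_ge0// andbT.
by rewrite real_innerC subrr.
Qed.

Lemma edge_inner_eq0 u : L2_01 u -> edge_inner u u = 0 ->
  {ae mu, forall t, t \in `[0, 1] -> u t = 0}.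
Proof.
move=> u2; rewrite edge_innerE// => /eqP; rewrite eq_complex/= => /andP[+ _].
rewrite paddr_eq0 ?real_inner_ge0// => /andP[/eqP r0 /eqP i0]; case: u2 => u1 u2.
apply: (@filterS2 _ _ (ae_filter_ringOfSetsType mu) _ _ _ _
  (real_inner_eq0 u1 r0) (real_inner_eq0 u2 i0)) => t rt it t01.
by apply/eqP; rewrite eq_complex/= rt// it// eqxx.
Qed.

Lemma edge_inner_ae u v w : L2_01 u -> L2_01 v -> L2_01 w ->
  {ae mu, forall t, t \in `[0, 1] -> u t = v t} -> edge_inner u w = edge_inner v w.
Proof.
move=> u2 v2 w2 uv; rewrite !edge_innerE//; case: u2 v2 w2 => [u1 u2] [v1 v2] [w1 w2].
have r : {ae mu, forall t, t \in `[0, 1] -> complex.Re (u t) = complex.Re (v t)}.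
  by apply: (@filterS _ _ (ae_filter_ringOfSetsType mu) _ _ _ uv) => t ut t01; rewrite ut.
have i : {ae mu, forall t, t \in `[0, 1] -> complex.Im (u t) = complex.Im (v t)}.
  by apply: (@filterS _ _ (ae_filter_ringOfSetsType mu) _ _ _ uv) => t ut t01; rewrite ut.
by congr (_ +i* _); congr (_ + _); rewrite ?(real_inner_ae u1 v1 _ r)// ?(real_inner_ae u2 v2 _ i).
Qed.

End InnerProduct.

(** * Eigenvectors of an operator and of its square root *)

Section SquareRoot.
Variables (R : realType) (T E : choiceType) (G : mgraph T E).
Local Notation C := R[i].
Local Notation mu := (@lebesgue_measure R).
Local Open Scope complex_scope.
Hypothesis finE : finite_set (mg_edge G).
Implicit Types (y f g u : gfun R E) (A B : goper R E) (P Q : R -> Prop).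

Lemma innerE f y : inner G f y = \sum_(e <- fset_set (mg_edge G)) edge_inner (f e) (y e).
Proof. by rewrite /inner fsbig_finite. Qed.

Lemma mem_edge_seq e : e \in fset_set (mg_edge G) -> mg_edge G e.
Proof. by rewrite in_fset_set// inE. Qed.

Lemma inner_comb (a b : C) f g u : L2 G f -> L2 G g -> L2 G u ->
  inner G (fun e t => a * f e t + b * g e t) u = a * inner G f u + b * inner G g u.
Proof.
move=> f2 g2 u2; rewrite !innerE !mulr_sumr -big_split; apply: eq_big_seq => e /mem_edge_seq eG.
by rewrite /= edge_inner_comb; auto.
Qed.

Lemma L2_comb (a b : C) f g : L2 G f -> L2 G g -> L2 G (fun e t => a * f e t + b * g e t).
Proof. by move=> f2 g2 e eG; apply: L2_01_comb; auto. Qed.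

Lemma inner_conj f g : L2 G f -> L2 G g -> inner G g f = (inner G f g)^*.
Proof.
move=> f2 g2; rewrite !innerE rmorph_sum; apply: eq_big_seq => e /mem_edge_seq eG.
by rewrite /= edge_inner_conj; auto.
Qed.

Lemma inner_ge0 f : L2 G f -> 0 <= inner G f f.
Proof.
move=> f2; rewrite innerE big_seq_cond; apply: sumr_ge0 => e /andP[/mem_edge_seq eG _].
by rewrite edge_inner_ge0; auto.
Qed.

Lemma inner_eq0 f : L2 G f -> inner G f f = 0 -> ae_eq_on G f (fun _ _ => 0).
Proof.
move=> f2; rewrite innerE => /eqP; rewrite big_seq_cond psumr_eq0; last first.
  by move=> e /andP[/mem_edge_seq eG _]; rewrite edge_inner_ge0; auto.
move=> /allP h e eG; apply: edge_inner_eq0; first exact: f2.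
have es : e \in fset_set (mg_edge G) by rewrite in_fset_set// inE.
by have := h e es; rewrite es => /eqP.
Qed.

Lemma inner_ae f g u : L2 G f -> L2 G g -> L2 G u -> ae_eq_on G f g ->
  inner G f u = inner G g u.
Proof.
move=> f2 g2 u2 fg; rewrite !innerE; apply: eq_big_seq => e /mem_edge_seq eG.
by apply: edge_inner_ae; auto.
Qed.

(** Operators are bare relations; linearity follows from coinciding with the adjoint. *)
Lemma self_adjoint_comb B (a b : C) y f u g : self_adjoint G B -> B y f -> B u g ->
  B (fun e t => a * y e t + b * u e t) (fun e t => a * f e t + b * g e t).
Proof.
move=> [_ sB] Byf Bug; have [y2 f2 yf] := (sB _ _).1 Byf; have [u2 g2 ug] := (sB _ _).1 Bug.
apply/sB; split; [exact: L2_comb|exact: L2_comb|move=> v h Bvh].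
have [v2 h2 _] := (sB _ _).1 Bvh.
by rewrite !inner_comb// (yf _ _ Bvh) (ug _ _ Bvh).
Qed.

(* [u = B y - s y] satisfies [B u = - s u], so u = 0 as B is nonnegative. *)
Lemma sqrt_eigenvector A B s y : is_sqrt G A B -> 0 <= s ->
  eigenvector A (s ^+ 2) y -> eigenvector B s y.
Proof.
move=> [sa nn sq] s0 /sq[g [Byg Bgf]]; have [_ sB] := sa.
have [y2 g2 yg] := (sB _ _).1 Byg.
pose u : gfun R E := fun e t => 1 * g e t + (- s%:C) * y e t.
have u2 : L2 G u by exact: L2_comb.
have Bu : B u (fun e t => (- s%:C) * u e t).
  have := self_adjoint_comb 1 (- s%:C) sa Bgf Byg; congr B.
  apply/funext => e; apply/funext => t; rewrite /u rmorphXn; ring.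
have u0 : ae_eq_on G u (fun _ _ => 0).
  apply: inner_eq0 => //.
  (* For s = 0 nonnegativity gives no information. In this case u = B y, and its squared norm is the
     inner product of y with B (B y) = 0. *)
  move: s0; rewrite le_eqVlt => /predU1P[s0|s0].
    have uE : u = g.
      by apply/funext => e; apply/funext => t; rewrite /u -s0 oppr0 mul0r addr0 mul1r.
    rewrite uE (yg _ _ Bgf).
    have -> : (fun e t => (s ^+ 2)%:C * y e t) = (fun e t => 0 * g e t + 0 * y e t).
      by apply/funext => e; apply/funext => t; rewrite -s0 expr0n !mul0r addr0.
    have z2 : L2 G (fun e t => 0 * g e t + 0 * y e t) by exact: L2_comb.
    by rewrite inner_conj// inner_comb// !mul0r addr0 conjc0.
  have := nn _ _ Bu.
  have -> : (fun e t => - s%:C * u e t) = (fun e t => - s%:C * u e t + 0 * u e t).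
    by apply/funext => e; apply/funext => t; rewrite mul0r addr0.
  rewrite inner_comb// mul0r addr0 mulNr oppr_ge0 => h.
  have sC : 0 < s%:C :> C by rewrite ltcR.
  apply/le_anti; rewrite inner_ge0// andbT.
  by rewrite -(pmulr_rle0 _ sC).
have gy : ae_eq_on G (fun e t => s%:C * y e t) g.
  move=> e eG; apply: (@filterS _ _ (ae_filter_ringOfSetsType mu) _ _ _ (u0 e eG)) => t ut t01.
  by apply/esym/eqP; rewrite -subr_eq0 -(ut t01) /u mul1r mulNr.
have sy2 : L2 G (fun e t => s%:C * y e t).
  have := @L2_comb s%:C 0 y y y2 y2; congr L2.
  by apply/funext => e; apply/funext => t; rewrite mul0r addr0.
(* B y equals s y only almost everywhere. The adjoint sees only inner products, so the pair (y, s y)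
   belongs to B as well. *)
apply/sB; split=> // v h Bvh; have [v2 h2 _] := (sB _ _).1 Bvh.
by rewrite (inner_ae sy2 g2 v2 gy) (yg _ _ Bvh).
Qed.

Lemma eigenvector_sqrt A B s y : is_sqrt G A B ->
  eigenvector B s y -> eigenvector A (s ^+ 2) y.
Proof.
move=> [sa _ sq] By; apply/sq; exists (fun e t => s%:C * y e t); split=> //.
have := self_adjoint_comb s%:C 0 sa By By; congr B.
  by apply/funext => e; apply/funext => t; rewrite mul0r addr0.
by apply/funext => e; apply/funext => t; rewrite mul0r addr0 rmorphXn /= expr2 mulrA.
Qed.

Lemma mult_ge_restriction A B P Q n : is_sqrt G A B ->
  (forall s, P s -> 0 <= s /\ Q s) ->
  mult_ge G A (fun m => exists2 s, P s & m = s ^+ 2) n ->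
  mult_ge G (spectral_restriction G B Q) P n.
Proof.
move=> sqB PQ [m [y [yli my]]].
have /choice[s sP] : forall j, exists s, P s /\ m j = s ^+ 2.
  by move=> j; have [[s Ps ms] _] := my j; exists s.
exists s, y; split=> // j; have [Ps ms] := sP j; have [s0 Qs] := PQ _ Ps; split=> //.
have Bs : eigenvector B (s j) (y j).
  by apply: (sqrt_eigenvector sqB s0); rewrite -ms; have [_] := my j.
split=> //; exists 1%N, (fun=> s j), (fun=> y j); split=> // e eG; apply: aeW => t _.
by rewrite big_ord1.
Qed.

(** The sign of s comes from [s <y, y> = <B y, y> >= 0] and y being nonzero by independence. *)
Lemma restriction_mult_ge A B P Q n : is_sqrt G A B ->
  mult_ge G (spectral_restriction G B Q) P n ->
  mult_ge G A (fun m => exists2 s, 0 <= s /\ P s & m = s ^+ 2) n.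
Proof.
move=> sqB [s [y [yli sy]]]; exists (fun j => s j ^+ 2), y; split=> // j.
have [Ps [Bs _]] := sy j; split; last exact: eigenvector_sqrt Bs.
exists (s j) => //; split=> //.
have [sa nn _] := sqB; have [_ sB] := sa; have [y2 sy2 _] := (sB _ _).1 Bs.
have := nn _ _ Bs.
have -> : (fun e t => (s j)%:C * y j e t) = (fun e t => (s j)%:C * y j e t + 0 * y j e t).
  by apply/funext => e; apply/funext => t; rewrite mul0r addr0.
have yy : 0 < inner G (y j) (y j).
  rewrite lt0r inner_ge0// andbT; apply/eqP => /(inner_eq0 y2).
  exact: lin_indep_neq0.
by rewrite inner_comb// mul0r addr0 pmulr_lge0// lecR.
Qed.

End SquareRoot.

(** * The fundamental domain *)

(** Periodicity is given only for the basis vectors; this induction extends it to all of Z^d. *)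
Lemma int_row_ind d (P : 'rV[int]_d -> Prop) : P 0 ->
  (forall m n, P m -> P n -> P (m + n)) ->
  (forall s, P (delta_mx 0 s)) -> (forall s, P (- delta_mx 0 s)) -> forall m, P m.
Proof.
move=> P0 PD P1 PN m; rewrite [m]row_sum_delta.
apply: (big_ind P) => // s _.
have PM (v : 'rV[int]_d) k : P v -> P (v *+ k).
  by move=> Pv; elim: k => [|k IH]; rewrite ?mulr0n// mulrS; exact: PD.
case: (m 0 s) => k; last rewrite NegzE scaleNr -scalerN.
  by rewrite -[Posz k]/(k%:Z) -natz scaler_nat; exact: PM.
by rewrite -natz scaler_nat; exact: PM.
Qed.

(** * The action of Z^d on vertices and edges *)

Section Lattice.
Variables (R : realType) (d : nat) (Gam : periodic_graph R d).
Local Notation E := (pg_edge Gam).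
Local Notation pt := 'rV[R]_d.
Local Notation tr := (@translate R d Gam).
Local Notation ip := (@int_part R d Gam).
Local Notation fp := (@frac_part R d Gam).
Local Notation etr := (@edge_translate R d Gam).
Implicit Types (m n : 'rV[int]_d) (x v : pt) (e : E).

Lemma translate0 x : tr 0 x = x.
Proof. by rewrite /translate map_mx0 mul0mx addr0. Qed.

Lemma translateD m n x : tr (m + n) x = tr m (tr n x).
Proof. by rewrite /translate map_mxD mulmxDl addrA addrAC. Qed.

Lemma coord_translate m x : Defs.coord Gam (tr m x) = Defs.coord Gam x + map_mx intr m.
Proof. by rewrite /Defs.coord /translate mulmxDl mulmxK// pg_basisP. Qed.

Lemma int_part_translate m x : ip (tr m x) = m + ip x.
Proof.
by apply/rowP => j; rewrite /int_part coord_translate !mxE addrC floorDzr ?intr_int// intrKfloor.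
Qed.

Lemma int_part_frac x : ip (fp x) = 0.
Proof. by rewrite /frac_part int_part_translate addNr. Qed.

Lemma frac_part_translate m x : fp (tr m x) = fp x.
Proof. by rewrite /frac_part int_part_translate -translateD opprD addrAC addNr add0r. Qed.

Lemma translate_frac x : tr (ip x) (fp x) = x.
Proof. by rewrite /frac_part -translateD subrr translate0. Qed.

Lemma translate_eq0 m x : tr m x = x -> m = 0.
Proof.
by move=> /(congr1 ip); rewrite int_part_translate -[RHS]add0r => /addIr.
Qed.

Lemma cellE x : cell Gam x <-> ip x = 0.
Proof.
split=> [cx|ix j].
  apply/rowP => j; rewrite [LHS]mxE [RHS]mxE; apply/floor_def.
  by rewrite /= add0r; exact: cx.
have := congr1 (fun r : 'rV[int]_d => r 0 j) ix; rewrite [LHS]mxE [RHS]mxE => fl.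
by have := floor_itv (Defs.coord Gam x 0 j); rewrite fl add0r.
Qed.

Lemma cell_frac x : cell Gam (fp x).
Proof. by apply/cellE; exact: int_part_frac. Qed.

Lemma frac_cell x : cell Gam x -> fp x = x.
Proof. by move=> /cellE ix; rewrite /frac_part ix oppr0 translate0. Qed.

Lemma translate_delta s x : tr (delta_mx 0 s) x = x + row s (pg_basis Gam).
Proof. by rewrite /translate map_delta_mx rowE. Qed.

Lemma translate_Ndelta s x : tr (- delta_mx 0 s) x = x - row s (pg_basis Gam).
Proof. by rewrite /translate map_mxN map_delta_mx mulNmx -rowE. Qed.

Lemma vert_translate m v : pg_vert Gam v -> pg_vert Gam (tr m v).
Proof.
move: m v; apply: int_row_ind => [v|m n Pm Pn v|s v|s v].
- by rewrite translate0.
- by move=> /Pn/Pm; rewrite translateD.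
- by rewrite translate_delta; exact: (@pg_periodicV _ _ Gam s v).1.
- by move=> vV; apply/(@pg_periodicV _ _ Gam s); rewrite translate_Ndelta subrK.
Qed.

Lemma VF_frac v : pg_vert Gam v -> VF Gam (fp v).
Proof. by move=> vV; split; [exact: vert_translate|exact: cell_frac]. Qed.

Lemma edge_translateD m n e e' e'' : etr n e e' -> etr m e' e'' -> etr (m + n) e e''.
Proof. by move=> h h' t t01; rewrite h'// h// translateD. Qed.

Lemma edge_translate_exists m e : exists e', etr m e e'.
Proof.
move: m e; apply: int_row_ind => [e|m n Pm Pn e|s e|s e].
- by exists e => t _; rewrite translate0.
- by have [e' h] := Pn e; have [e'' h'] := Pm e'; exists e''; exact: edge_translateD h h'.
- have [[e' h] _] := pg_periodicE s e; exists e' => t t01.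
  by rewrite translate_delta h.
- have [_ [e' h]] := pg_periodicE s e; exists e' => t t01.
  by rewrite translate_Ndelta h.
Qed.

Lemma edge_translate_sym m e e' : etr m e e' -> etr (- m) e' e.
Proof. by move=> h t t01; rewrite h// -translateD addNr translate0. Qed.

Lemma edge_translate_uniq m e e' e'' : etr m e e' -> etr m e e'' -> e' = e''.
Proof.
(* Two edges that share an interior point, here the midpoint, are equal. *)
move=> h h'; have t01 : 0 < (2^-1 : R) < 1 by lra.
have t01' : 0 <= (2^-1 : R) <= 1 by lra.
by have [] := @pg_curve_inj _ _ Gam e' e'' 2^-1 2^-1 t01 t01; rewrite ?h ?h'.
Qed.

Lemma edge_translate_end m e e' (b : bool) : etr m e e' ->
  pg_curve e' b%:R = tr m (pg_curve e b%:R).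
Proof. by move=> h; rewrite h//; case: b; rewrite ?lexx ?ler01. Qed.

Lemma edge_index_translate m e e' : etr m e e' -> edge_index e' = edge_index e.
Proof.
move=> h; rewrite /edge_index (edge_translate_end true h) (edge_translate_end false h).
by rewrite !int_part_translate opprD addrACA subrr add0r.
Qed.

End Lattice.

Section Touching.
Variables (T E : choiceType) (G : mgraph T E).

Definition incident (v : T) : Prop := exists e b, mg_edge G e /\ mg_end G e b = v.

(** Being equal or both incident to edges is a relation that contains adjacency and survives
    reflexive, symmetric and transitive closure. *)
Lemma connected_incident u v : connected_graph G -> mg_vert G u -> mg_vert G v ->
  u <> v -> incident v.
Proof.
move=> conn uG vG uv.
have : u = v \/ (incident u /\ incident v).
  elim: (conn u v uG vG) => {uG vG uv conn u v}
    [x y [e [eG ex ey]]|x|x y _ [->|[? ?]]|x y z _ h1 _ h2].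
  - by right; split; [exists e, false|exists e, true].
  - by left.
  - by left.
  - by right.
  - case: h1 h2 => [->//|[ix iy]] [<-|[_ iz]]; right; by split.
by case=> [//|[]].
Qed.

End Touching.

Lemma ncard_subset_eq (T : choiceType) (A B : set T) : finite_set B -> A `<=` B ->
  ncard A = ncard B -> A = B.
Proof.
move=> fB AB; have fA := sub_finite_set AB fB.
have sub : (fset_set A `<=` fset_set B)%fset.
  by apply/fsubsetP => x; rewrite !in_fset_set// !inE; exact: AB.
move=> /eqP; rewrite /ncard => /eqP cE.
have /(fsubset_cardP cE) AB' := sub.
by apply: (fset_set_inj fA fB); apply/fsetP.
Qed.

Lemma ncard_enum (T : choiceType) (A : set T) : finite_set A ->
  exists vv : 'I_(ncard A) -> T, injective vv /\ forall v, A v <-> exists i, vv i = v.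
Proof.
move=> fA; pose s : seq T := fset_set A.
have us : uniq s by exact: fset_uniq.
have ms v : (v \in s) = (v \in A) by rewrite in_fset_set.
exists (fun i => tnth (in_tuple s) i); split.
  by apply/injectiveP; rewrite /injectiveb/dinjectiveb/= map_tnth_enum.
move=> v; rewrite -[A v]inE -ms; split=> [vs|[i <-]]; last exact: mem_tnth.
by have /tnthP[i ->] : v \in in_tuple s by []; exists i.
Qed.

(** * Inner vertices and representatives of edge orbits *)

Section FundamentalDomain.
Variables (R : realType) (d : nat) (Gam : periodic_graph R d) (G1 : fundamental_domain Gam).
Local Notation E := (pg_edge Gam).
Local Notation tr := (@translate R d Gam).
Local Notation ip := (@int_part R d Gam).
Local Notation fp := (@frac_part R d Gam).
Local Notation etr := (@edge_translate R d Gam).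
Local Notation FG := (fundamental_graph Gam).
Implicit Types (e : E).

Lemma exists_edge : exists e : E, True.
Proof.
have [v vV] : exists v, pg_vert Gam v.
  apply: contrapT => h; apply: (pg_infinite (p := Gam)).
  suff -> : pg_vert Gam = set0 by exact: finite_set0.
  by apply/seteqP; split=> // x xV; case: h; exists x.
have [u uV uv] : exists2 u, pg_vert Gam u & u <> v.
  apply: contrapT => h; apply: (pg_infinite (p := Gam)).
  apply: (@sub_finite_set _ _ [set v]) => [x xV|]; last exact: finite_set1.
  by apply: contrapT => xv; case: h; exists x.
by have [e _] := connected_incident (@pg_connected _ _ Gam) uV vV uv; exists e.
Qed.

(** If v is the only vertex of the domain, an edge of the domain, which exists because the domain
    covers the edges of [Gam], must be a loop at v. *)
Lemma fd_incident v : fd_vert G1 v -> incident (fd_graph G1) v.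
Proof.
move=> v1; have [[u u1 uv]|h] := pselect (exists2 u, fd_vert G1 u & u <> v).
  exact: (connected_incident (fd_connected (f := G1)) u1 v1 uv).
have [e _] := exists_edge; have [m [e' [e'1 _]]] := fd_coverE G1 e.
exists e', false; split=> //; apply: contrapT => ne; apply: h.
by exists (pg_curve e' false%:R) => //; exact: fd_ends.
Qed.

Lemma inner_ends_at v : inner_vertices G1 v ->
  ends_at (pg_graph Gam) v = ends_at (fd_graph G1) v.
Proof.
move=> [v1 dv]; apply/esym/ncard_subset_eq => //.
  by apply: pg_degree_finite; exact: (fd_subV (f := G1)).
by move=> [e b] [].
Qed.

(* All edges at v and an edge e at v + m lie in the fundamental domain, hence so
   does e - m, which must then be e. *)
Lemma inner_rigid m v : inner_vertices G1 v -> fd_vert G1 (tr m v) -> m = 0.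
Proof.
move=> vo v1; have [e [b [e1 eb]]] := fd_incident v1.
have [e' ee'] := edge_translate_exists (- m) e.
have e'v : ends_at (pg_graph Gam) v (e', b).
  split=> //=; rewrite (edge_translate_end b ee').
  by move: eb => /= ->; rewrite -translateD addNr translate0.
move: e'v; rewrite (inner_ends_at vo) => -[/= e'1 _].
have e'E := fd_inequiv e1 e'1 ee'.
apply/oppr_inj; rewrite oppr0.
apply: (@translate_eq0 _ _ Gam _ (pg_curve e false%:R)).
by rewrite -(edge_translate_end false ee') -e'E.
Qed.

(** The translate of v in the cell also belongs to the domain, which contains [VF]; rigidity makes
    the translation trivial. *)
Lemma inner_cell v : inner_vertices G1 v -> cell Gam v.
Proof.
move=> vo; apply/cellE/oppr_inj; rewrite oppr0; apply: (inner_rigid vo).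
by apply: fd_VF; apply: VF_frac; apply: (fd_subV (f := G1)); case: vo.
Qed.

Lemma inner_VF v : inner_vertices G1 v -> VF Gam v.
Proof.
by move=> vo; split; [apply: (fd_subV (f := G1)); case: vo|exact: inner_cell].
Qed.

Lemma VF_finite : finite_set (VF Gam).
Proof. exact: sub_finite_set (fd_VF G1) (fd_finiteV G1). Qed.

Definition edge_rep e : E := projT1 (cid (edge_translate_exists (- ip (pg_curve e 0)) e)).

Lemma edge_repP e : etr (- ip (pg_curve e 0)) e (edge_rep e).
Proof. exact: projT2 (cid _). Qed.

Lemma frac_edge_rep e (b : bool) : fp (pg_curve (edge_rep e) b%:R) = fp (pg_curve e b%:R).
Proof. by rewrite (edge_translate_end b (edge_repP e)) frac_part_translate. Qed.

(** Both edge sets contain exactly one member of each orbit: the domain by [fd_inequiv] and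
    [fd_coverE], the fundamental graph by normalizing the initial vertex. *)
Lemma edge_rep_bij : set_bij (fd_edge G1) (mg_edge FG) edge_rep.
Proof.
split.
- move=> e _ /=; rewrite -[0]/(false%:R) (edge_translate_end false (edge_repP e)).
  exact: cell_frac.
- move=> e e' /set_mem e1 /set_mem e'1 ee'.
  have h := edge_repP e; rewrite ee' in h.
  have h' := edge_translateD h (edge_translate_sym (edge_repP e')).
  exact: (fd_inequiv e1 e'1 h').
- move=> e' /= ce'; have [m [e [e1 ee']]] := fd_coverE G1 e'.
  exists e => //; apply: edge_translate_uniq (edge_repP e) _.
  suff -> : - ip (pg_curve e 0) = m by [].
  move: ce'; rewrite -[0]/(false%:R) (edge_translate_end false ee') => /cellE.
  by rewrite int_part_translate => /eqP; rewrite addr_eq0 => /eqP ->.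
Qed.

Lemma fundamental_graph_finite : finite_set (mg_edge FG).
Proof.
have [_ _ surj] := edge_rep_bij.
exact: sub_finite_set surj (finite_image _ (fd_finiteE G1)).
Qed.

Lemma sum_fundamental_edges (V : nmodType) (F : E -> V) :
  \sum_(e <- fset_set (mg_edge FG)) F e = \sum_(e <- fset_set (fd_edge G1)) F (edge_rep e).
Proof.
rewrite -!fsbig_finite; [|exact: fd_finiteE|exact: fundamental_graph_finite].
exact: (reindex_fsbig edge_rep _ _ _ edge_rep_bij).
Qed.

Lemma VF_incident v : VF Gam v -> incident FG v.
Proof.
move=> vF; have [e [b [e1 eb]]] := fd_incident (fd_VF G1 vF).
exists (edge_rep e), b; split; first by have [h _ _] := edge_rep_bij; exact: h.
by rewrite /= frac_edge_rep; move: eb => /= ->; apply: frac_cell; case: vF.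
Qed.

End FundamentalDomain.

(** * Interlacing *)

Section SpectralLevels.
Variables (R : realType) (T E : choiceType).
Local Notation C := R[i].
Local Open Scope complex_scope.
Variables (G : mgraph T E) (a : E -> R) (D : set T).
Hypothesis finE : finite_set (mg_edge G).
Hypothesis endsV : forall e b, mg_edge G e -> mg_vert G (mg_end G e b).
Variables (N : nat) (vv : 'I_N -> T).
Hypothesis vv_inj : injective vv.
Hypothesis vvP : forall v, (mg_vert G v /\ ~ D v) <-> exists i, vv i = v.
Hypothesis has_end : forall i, incident G (vv i).

Local Notation es := (fset_set (mg_edge G) : seq E).
Local Notation ph := (fun e => cis (a e)).
Local Notation A := (adj_mx es (mg_end G) ph vv).
Local Notation d := (deg_row C es (mg_end G) vv).
Local Notation lap := (dirichlet_magnetic_laplacian G a D).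

(** The shared description of Floquet, Neumann and Dirichlet eigenvalues. Upper bounds use its
    minimality, applied to a subspace carried over from the other operator. *)
Definition form_level n (l : R) : Prop :=
  [/\ 0 <= l <= pi, form_ge A (diag_mx d) (cos l)%:C n &
      forall k, 0 <= k <= pi -> form_ge A (diag_mx d) (cos k)%:C n -> l <= k].

Lemma mult_ge_sub B (P Q : R -> Prop) n : (forall m, P m -> Q m) ->
  mult_ge G B P n -> mult_ge G B Q n.
Proof.
move=> PQ [m [y [yli my]]]; exists m, y; split=> // j.
by have [/PQ ? ?] := my j.
Qed.

Let Ah : A ^t* = A := adj_mx_herm es (mg_end G) ph vv.
Let d0 : forall i, 0 < d 0 i := deg_row_gt0 C (has_end_seq finE has_end).

Lemma eigen_to_form k n : 0 <= k < pi ->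
  mult_ge G lap (fun m => m <= k ^+ 2) n -> form_ge A (diag_mx d) (cos k)%:C n.
Proof.
by move=> kpi h; apply: (pencil_ge_form Ah d0); apply: eigen_to_pencil h.
Qed.

Lemma form_to_eigen k n : 0 <= k <= pi -> form_ge A (diag_mx d) (cos k)%:C n ->
  mult_ge G lap (fun m => exists2 s, 0 <= s <= k & m = s ^+ 2) n.
Proof.
move=> kpi h; apply: (pencil_to_eigen finE vv_inj vvP has_end kpi).
by apply: (form_ge_pencil Ah d0) => //; exact: realC_real.
Qed.

Lemma form_ge_pi n : (n <= N)%N -> form_ge A (diag_mx d) (cos pi)%:C n.
Proof.
rewrite cospi rmorphN1; apply: form_ge_Nid => //; exact: unit_phase.
Qed.

(** The bound [l <= pi] follows from minimality, as the form condition holds at pi. If [l = pi],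
    this also gives the form condition itself, so eigenfunctions that vanish at all vertices never
    enter. *)
Lemma eigenvalue_form_level n l : (n <= N)%N -> 0 <= l ->
  nth_eigenvalue G lap n (l ^+ 2) -> form_level n l.
Proof.
move=> nN l0 [hle hlt].
have min k : 0 <= k <= pi -> form_ge A (diag_mx d) (cos k)%:C n -> l <= k.
  move=> kpi /(form_to_eigen kpi) h; rewrite leNgt; apply/negP => kl; apply: hlt.
  apply: mult_ge_sub h => _ [s /andP[s0 sk] ->].
  by rewrite ltr_sqr//; exact: le_lt_trans sk kl.
have pi0 := pi_ge0 R.
have lpi : l <= pi by apply: min (form_ge_pi nN); rewrite pi0 lexx.
split=> //; first by rewrite l0.
move: lpi; rewrite le_eqVlt => /predU1P[->|lpi]; first exact: form_ge_pi.
by apply: eigen_to_form hle; rewrite l0.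
Qed.

Lemma restricted_sqrt_form_level Omega n l : (1 <= n <= N)%N ->
  is_sqrt_restricted_0pi G lap Omega -> nth_eigenvalue G Omega n l -> form_level n l.
Proof.
move=> /andP[n1 nN] [B [sqB ->]] [hle hlt].
have min k : 0 <= k <= pi -> form_ge A (diag_mx d) (cos k)%:C n -> l <= k.
  move=> kpi /(form_to_eigen kpi) h; rewrite leNgt; apply/negP => kl; apply: hlt.
  have [k0 k1] := andP kpi.
  apply: (@mult_ge_sub _ (fun s => 0 <= s <= k)) => [s /andP[_ sk]|].
    exact: le_lt_trans sk kl.
  apply: (mult_ge_restriction finE sqB) h => s /andP[s0 sk].
  by rewrite s0 (le_trans sk k1).
have := restriction_mult_ge finE sqB hle => hle'.
(* As [n >= 1], there is at least one eigenvalue of the root in [0, l]. *)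
have l0 : 0 <= l.
  have [m [y [_ my]]] := hle'; have [[s [s0 sl] _] _] := my (Ordinal n1).
  exact: le_trans s0 sl.
have pi0 := pi_ge0 R.
have lpi : l <= pi by apply: min (form_ge_pi nN); rewrite pi0 lexx.
split=> //; first by rewrite l0.
move: lpi; rewrite le_eqVlt => /predU1P[->|lpi]; first exact: form_ge_pi.
apply: eigen_to_form; first by rewrite l0.
apply: mult_ge_sub hle' => _ [s [s0 sl] ->].
by rewrite ler_sqr.
Qed.

End SpectralLevels.

(** * Comparison of the Floquet, Neumann and Dirichlet forms *)

Section Interlacing.
Variables (R : realType) (d : nat) (Gam : periodic_graph R d) (G1 : fundamental_domain Gam).
Variable theta : 'rV[R]_d.
Local Notation C := R[i].
Local Open Scope complex_scope.
Local Notation E := (pg_edge Gam).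
Local Notation ip := (@int_part R d Gam).
Local Notation fp := (@frac_part R d Gam).
Local Notation FG := (fundamental_graph Gam).
Variables (nu nu1 nuo : nat).
Variables (vF : 'I_nu -> 'rV[R]_d) (v1 : 'I_nu1 -> 'rV[R]_d) (vo : 'I_nuo -> 'rV[R]_d).
Hypotheses (vF_inj : injective vF) (v1_inj : injective v1) (vo_inj : injective vo).
Hypothesis vFP : forall v, VF Gam v <-> exists i, vF i = v.
Hypothesis v1P : forall v, fd_vert G1 v <-> exists i, v1 i = v.
Hypothesis voP : forall v, inner_vertices G1 v <-> exists i, vo i = v.

Definition potential (e : E) : R := \sum_(j < d) (edge_index e 0 j)%:~R * theta 0 j.

(** The sign is chosen so that the ratio of these phases along an edge cancels [cis (potential e)];
    see [phase_bloch]. *)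
Definition bloch_phase (v : 'rV[R]_d) : C := cis (- \sum_(j < d) (ip v 0 j)%:~R * theta 0 j).

Local Notation esF := (fset_set (mg_edge FG)).
Local Notation es1 := (fset_set (fd_edge G1)).
Local Notation AF := (adj_mx esF (mg_end FG) (fun e => cis (potential e)) vF).
Local Notation DF := (diag_mx (deg_row C esF (mg_end FG) vF)).
Local Notation A1 := (adj_mx es1 (mg_end (fd_graph G1)) (fun=> cis (0 : R)) v1).
Local Notation D1 := (diag_mx (deg_row C es1 (mg_end (fd_graph G1)) v1)).
Local Notation Ao := (adj_mx es1 (mg_end (fd_graph G1)) (fun=> cis (0 : R)) vo).
Local Notation Do := (diag_mx (deg_row C es1 (mg_end (fd_graph G1)) vo)).

Lemma conjC_cis (r : R) : (cis r)^*%R = cis (- r).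
Proof. by rewrite -[LHS]/(conjc _) cis_conj. Qed.

Lemma bloch_phase_cell v : cell Gam v -> bloch_phase v = 1.
Proof.
move=> /cellE iv; rewrite /bloch_phase iv big1 ?oppr0 ?cis0// => j _.
by rewrite mxE mul0r.
Qed.

Lemma phase_bloch e (b : bool) : phase (fun e => cis (potential e)) e b =
  bloch_phase (pg_curve e (~~ b)%:R) * (bloch_phase (pg_curve e b%:R))^*%R.
Proof.
rewrite /bloch_phase conjC_cis opprK -cisD phaseE.
have pE : potential e = (\sum_(j < d) (ip (pg_curve e true%:R) 0 j)%:~R * theta 0 j) -
    (\sum_(j < d) (ip (pg_curve e false%:R) 0 j)%:~R * theta 0 j).
  rewrite /potential -sumrB; apply: eq_bigr => j _.
  by rewrite -mulrBl -rmorphB /edge_index !mxE.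
by congr cis; rewrite pE; case: b => /=; ring.
Qed.

(** The hypothesis says that F depends on the orbit of the edge only, so the sum can be taken over
    the representatives in the domain. *)
Lemma fundamental_sum (F : E -> bool -> 'rV[R]_d -> 'rV[R]_d -> C) :
  (forall e b u v, F (edge_rep e) b u v = F e b u v) ->
  \sum_(e <- esF) \sum_(b : bool) F e b (mg_end FG e (~~ b)) (mg_end FG e b) =
  \sum_(e <- es1) \sum_(b : bool) F e b (fp (pg_curve e (~~ b)%:R)) (fp (pg_curve e b%:R)).
Proof.
move=> FE; rewrite (sum_fundamental_edges G1); apply: eq_bigr => e _; apply: eq_bigr => b _.
by rewrite /= !frac_edge_rep FE.
Qed.

Lemma adj_form_fundamental (x y : 'rV[C]_nu) :
  (x *m AF *m y ^t*) 0 0 = \sum_(e <- es1) \sum_(b : bool)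
  (bloch_phase (pg_curve e (~~ b)%:R) * ext vF x (fp (pg_curve e (~~ b)%:R))) *
  (bloch_phase (pg_curve e b%:R) * ext vF y (fp (pg_curve e b%:R)))^*%R.
Proof.
rewrite adj_formE (fundamental_sum (F := fun e b u v =>
  phase (fun e => cis (potential e)) e b * ext vF x u * (ext vF y v)^*%R)); last first.
  move=> e b u v; congr (_ * _ * _); rewrite !phaseE.
  by rewrite /potential (edge_index_translate (edge_repP e)).
apply: eq_bigr => e _; apply: eq_bigr => b _.
by rewrite phase_bloch rmorphM /=; ring.
Qed.

Lemma deg_form_fundamental (x y : 'rV[C]_nu) :
  (x *m DF *m y ^t*) 0 0 = \sum_(e <- es1) \sum_(b : bool)
  (bloch_phase (pg_curve e b%:R) * ext vF x (fp (pg_curve e b%:R))) *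
  (bloch_phase (pg_curve e b%:R) * ext vF y (fp (pg_curve e b%:R)))^*%R.
Proof.
rewrite deg_formE// (fundamental_sum (F := fun e b u v => ext vF x v * (ext vF y v)^*%R))//.
apply: eq_bigr => e _; apply: eq_bigr => b _.
have c1 : bloch_phase (pg_curve e b%:R) * (bloch_phase (pg_curve e b%:R))^*%R = 1.
  by rewrite /bloch_phase conjC_cis cisMN.
by rewrite rmorphM /= mulrACA c1 mul1r.
Qed.

(* Functions on the vertices of the fundamental graph extend quasi-periodically
   to Gamma; this gauges the potential away. *)
Definition bloch_mx : 'M[C]_(nu, nu1) :=
  \matrix_(i, j) ((vF i == fp (v1 j))%:R * bloch_phase (v1 j)).

Lemma ext_bloch (x : 'rV[C]_nu) v : fd_vert G1 v ->
  ext v1 (x *m bloch_mx) v = bloch_phase v * ext vF x (fp v).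
Proof.
move=> /v1P[j <-]; rewrite ext_vv// mxE /ext mulr_sumr; apply: eq_bigr => i _.
by rewrite mxE; ring.
Qed.

Lemma fd_edge_end e (b : bool) : e \in es1 -> fd_vert G1 (pg_curve e b%:R).
Proof. by rewrite in_fset_set ?inE; [exact: fd_ends|exact: fd_finiteE]. Qed.

Lemma adj_bloch : AF = bloch_mx *m A1 *m bloch_mx ^t*.
Proof.
apply: eq_mx_form => x y.
rewrite !mulmxA -[_ *m bloch_mx ^t* *m _]mulmxA -trmxC_mul adj_form_fundamental adj_formE.
apply: eq_big_seq => e e1; apply: eq_bigr => b _.
by rewrite phaseE oppr0 if_same cis0 mul1r /= !ext_bloch//; exact: fd_edge_end.
Qed.

Lemma deg_bloch : DF = bloch_mx *m D1 *m bloch_mx ^t*.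
Proof.
apply: eq_mx_form => x y.
rewrite !mulmxA -[_ *m bloch_mx ^t* *m _]mulmxA -trmxC_mul deg_form_fundamental deg_formE//.
apply: eq_big_seq => e e1; apply: eq_bigr => b _.
by rewrite /= !ext_bloch//; exact: fd_edge_end.
Qed.

(** The extension is injective because on [VF], where the phase is 1, it gives back the original
    values. *)
Lemma bloch_mx_free : row_free bloch_mx.
Proof.
apply: inj_row_free => x x0; apply/rowP => i; rewrite [RHS]mxE.
have vFi : VF Gam (vF i) by apply/vFP; exists i.
have := ext_bloch x (fd_VF G1 vFi).
rewrite x0 ext0 bloch_phase_cell; last by case: vFi.
by rewrite mul1r frac_cell ?ext_vv//; case: vFi.
Qed.

Definition inclusion_mx : 'M[C]_(nuo, nu) := \matrix_(i, j) (vo i == vF j)%:R.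

Lemma ext_inclusion (x : 'rV[C]_nuo) v : VF Gam v -> ext vF (x *m inclusion_mx) v = ext vo x v.
Proof.
move=> /vFP[j <-]; rewrite ext_vv// mxE /ext; apply: eq_bigr => i _.
by rewrite mxE.
Qed.

(* If v is not in the cell, neither v nor its translate in the cell is an inner vertex. *)
Lemma bloch_inner (x : 'rV[C]_nuo) v : fd_vert G1 v -> bloch_phase v * ext vo x (fp v) = ext vo x v.
Proof.
move=> v1v; have [cv|ncv] := pselect (cell Gam v).
  by rewrite bloch_phase_cell// frac_cell// mul1r.
rewrite !ext_out ?mulr0// => i iE.
  by apply: ncv; rewrite -iE; apply: (@inner_cell _ _ _ G1); apply/voP; exists i.
have vi : inner_vertices G1 (fp v) by apply/voP; exists i.
apply/ncv/cellE; apply: (inner_rigid vi); by rewrite translate_frac.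
Qed.

Lemma VF_frac_end e (b : bool) : e \in es1 -> VF Gam (fp (pg_curve e b%:R)).
Proof. by move=> e1; apply: VF_frac; apply: (fd_subV (f := G1)); exact: fd_edge_end. Qed.

Lemma adj_inclusion : Ao = inclusion_mx *m AF *m inclusion_mx ^t*.
Proof.
apply: eq_mx_form => x y.
rewrite !mulmxA -[_ *m inclusion_mx ^t* *m _]mulmxA -trmxC_mul adj_form_fundamental adj_formE.
apply: eq_big_seq => e e1; apply: eq_bigr => b _.
rewrite phaseE oppr0 if_same cis0 mul1r /= !ext_inclusion; try exact: VF_frac_end.
by rewrite !bloch_inner//; exact: fd_edge_end.
Qed.

Lemma deg_inclusion : Do = inclusion_mx *m DF *m inclusion_mx ^t*.
Proof.
apply: eq_mx_form => x y.
rewrite !mulmxA -[_ *m inclusion_mx ^t* *m _]mulmxA -trmxC_mul deg_form_fundamental deg_formE//.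
apply: eq_big_seq => e e1; apply: eq_bigr => b _.
rewrite /= !ext_inclusion; try exact: VF_frac_end.
by rewrite !bloch_inner//; exact: fd_edge_end.
Qed.

Lemma inclusion_mx_free : row_free inclusion_mx.
Proof.
apply: inj_row_free => x x0; apply/rowP => i; rewrite [RHS]mxE.
have voi : inner_vertices G1 (vo i) by apply/voP; exists i.
have := ext_inclusion x (inner_VF voi).
by rewrite x0 ext0 ext_vv.
Qed.

Local Notation levelF := (form_level FG potential vF).
Local Notation level1 := (form_level (fd_graph G1) (fun=> 0) v1).
Local Notation levelo := (form_level (fd_graph G1) (fun=> 0) vo).

Lemma neumann_le n l z : level1 n l -> levelF n z -> l <= z.
Proof.
move=> [_ _ h] [z0 zf _]; apply: h => //.
by apply: (form_ge_congr bloch_mx_free); rewrite -adj_bloch -deg_bloch.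
Qed.

Lemma le_dirichlet n l z : levelo n l -> levelF n z -> z <= l.
Proof.
move=> [l0 lf _] [_ _ h]; apply: h => //.
by apply: (form_ge_congr inclusion_mx_free); rewrite -adj_inclusion -deg_inclusion.
Qed.

(** The Floquet space has codimension [nu1 - nu] in the Neumann space, which is the shift of the
    index; the next lemma loses [nu - nuo] in the same way. *)
Lemma le_neumann n k l z : n = (k + nu - nu1)%N -> level1 k l -> levelF n z -> z <= l.
Proof.
move=> -> [l0 lf _] [_ _ h]; apply: h => //.
by rewrite adj_bloch deg_bloch; exact: form_ge_restrict bloch_mx_free lf.
Qed.

Lemma dirichlet_le n k l z : k = (n + nuo - nu)%N -> levelo k l -> levelF n z -> l <= z.
Proof.
move=> -> [_ _ h] [z0 zf _]; apply: h => //.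
by rewrite adj_inclusion deg_inclusion; exact: form_ge_restrict inclusion_mx_free zf.
Qed.

End Interlacing.

Theorem theorem1p1 (R : realType) (d : nat) (hd : (2 <= d)%N)
    (Gam : periodic_graph R d) (G1 : fundamental_domain Gam)
    (nu nu1 nuo : nat)
    (hnu : nu = ncard (VF Gam)) (hnu1 : nu1 = ncard (fd_vert G1))
    (hnuo : nuo = ncard (inner_vertices G1))
    (Omega1 Omegao : goper R (pg_edge Gam))
    (hOmega1 : is_sqrt_restricted_0pi (fd_graph G1) (neumann G1) Omega1)
    (hOmegao : is_sqrt_restricted_0pi (fd_graph G1) (dirichlet G1) Omegao)
    (z1 zo : nat -> R)
    (hz1 : forall k, (1 <= k <= nu1)%N ->
       nth_eigenvalue (fd_graph G1) Omega1 k (z1 k))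
    (hzo : forall k, (1 <= k <= nuo)%N ->
       nth_eigenvalue (fd_graph G1) Omegao k (zo k))
    (n : nat) (hn : (1 <= n <= nu)%N) :
  let J : set R :=
    if (n <= nuo)%N then `[z1 n, zo n]%classic else `[z1 n, pi]%classic in
  let K : set R :=
    if (n <= nu - nuo)%N then `[0, z1 (n + nu1 - nu)%N]%classic
    else `[zo (n + nuo - nu)%N, z1 (n + nu1 - nu)%N]%classic in
  band Gam n `<=` J `&` K.
Proof.
move=> J K z [theta [z0 zn]].
have [vF [vF_inj vFP]] := ncard_enum (VF_finite G1); rewrite -hnu in vF vF_inj vFP.
have [v1 [v1_inj v1P]] := ncard_enum (fd_finiteV G1); rewrite -hnu1 in v1 v1_inj v1P.
have fino : finite_set (inner_vertices G1).
  by apply: sub_finite_set (fd_finiteV G1) => v [].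
have [vo [vo_inj voP]] := ncard_enum fino; rewrite -hnuo in vo vo_inj voP.
(* Read off from the rank of the injective Bloch matrix; it makes the truncated index [n + nu1 - nu]
   exact. *)
have nu_le : (nu <= nu1)%N.
  have /eqP <- := bloch_mx_free theta vF_inj v1_inj vFP v1P; exact: rank_leq_col.
have /andP[n1 nnu] := hn.
have levelF : form_level (fundamental_graph Gam) (potential theta) vF n z.
  apply: (@eigenvalue_form_level _ _ _ _ _ set0) => //.
  - exact: fundamental_graph_finite G1.
  - by move=> e b _; apply: VF_frac; exact: pg_ends.
  - by move=> v; split=> [[vG _]|vG]; [exact/vFP|split=> //; exact/vFP].
  - by move=> i; apply: (VF_incident G1); apply/vFP; exists i.
  - by rewrite -magnetic_laplacianE.
have level1 k : (1 <= k <= nu1)%N -> form_level (fd_graph G1) (fun=> 0) v1 k (z1 k).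
  move=> hk; apply: (@restricted_sqrt_form_level _ _ _ _ _ set0 _ _ _ v1 _ _ _ Omega1) => //.
  - exact: fd_finiteE.
  - by move=> e b; exact: fd_ends.
  - by move=> v; split=> [[vG _]|vG]; [exact/v1P|split=> //; exact/v1P].
  - by move=> i; apply: fd_incident; apply/v1P; exists i.
  - by rewrite -metric_laplacianE.
  - exact: hz1.
have levelo k : (1 <= k <= nuo)%N -> form_level (fd_graph G1) (fun=> 0) vo k (zo k).
  move=> hk; apply: (@restricted_sqrt_form_level _ _ _ _ _ (boundary_vertices G1)
    _ _ _ vo _ _ _ Omegao) => //.
  - exact: fd_finiteE.
  - by move=> e b; exact: fd_ends.
  - move=> v; split=> [[v1v nb]|/voP vi].
      by apply/voP; apply: contrapT => ni; apply: nb.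
    by split=> [|[_]//]; case: vi.
  - move=> i; apply: fd_incident; suff [] : inner_vertices G1 (vo i) by [].
    by apply/voP; exists i.
  - by rewrite -metric_laplacianE.
  - exact: hzo.
have [/andP[_ zpi] _ _] := levelF.
have z1z : z1 n <= z.
  apply: (neumann_le vF_inj v1_inj vFP v1P (level1 _ _) levelF).
  by rewrite n1 (leq_trans nnu).
have zz1 : z <= z1 (n + nu1 - nu)%N.
  apply: (le_neumann vF_inj v1_inj vFP v1P _ (level1 _ _) levelF); lia.
split; rewrite /J /K; case: ifPn => h /=; rewrite in_itv/=.
- rewrite z1z; apply: (le_dirichlet vF_inj vo_inj vFP voP (levelo _ _) levelF).
  by rewrite n1.
- by rewrite z1z.
- by rewrite z0.
(* In this case [n > nu - nuo], so the Dirichlet index [n + nuo - nu] is at least 1. *)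
- rewrite zz1 andbT.
  apply: (dirichlet_le vF_inj vo_inj vFP voP _ (levelo _ _) levelF) => //; lia.
Qed.
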